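(* Let $S_{\boldsymbol\lambda}$ be a weighted shift on a directed tree $\mathcal T=(V,E)$ with weights $\boldsymbol\lambda=\{\lambda_v\}_{v \in V^\circ}\subseteq\mathbb C$ such that $\mathscr E_V \subseteq \mathcal D^\infty(S_{\boldsymbol\lambda})$. Suppose that there exist a system $\{\mu_v\}_{v \in V}$ of Borel probability measures on $\mathbb R_+$ and a system $\{\varepsilon_v\}_{v \in V}$ of nonnegative real numbers such that for every $u\in V$, $$\mu_u(\sigma) = \sum_{v \in \mathsf{Chi}(u)} |\lambda_v|^2 \int_\sigma \frac 1 s \, d\mu_v(s) + \varepsilon_u \delta_0(\sigma)\quad\text{for every Borel set } \sigma\subseteq\mathbb R_+.$$ Then $S_{\boldsymbol\lambda}$ is subnormal.
   Context: A directed tree is a directed graph $\mathcal T=(V,E)$ ($V\neq\varnothing$ the set of vertices, $E\subseteq\{(u,v)\in V\times V: u\neq v\}$ the set of edges) which is connected (as an undirected graph), has no circuits (no finite sequence of $n\geq 2$ distinct vertices $u_1,\dots,u_n$ with $(u_j,u_{j+1})\in E$ for $1\le j<n$ and $(u_n,u_1)\in E$), and such that each vertex $v$ that has an incoming edge has exactly one vertex $\mathsf{par}(v)$ (its parent) with $(\mathsf{par}(v),v)\in E$. A root is a vertex without incoming edges; a directed tree has at most one root, denoted $\mathsf{root}$. $V^\circ=V\setminus\{\mathsf{root}\}$ if there is a root and $V^\circ=V$ otherwise. $\mathsf{Chi}(u)=\{v\in V:(u,v)\in E\}$. $\ell^2(V)$ is the Hilbert space of square summable complex functions on $V$, $e_u$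 is the characteristic function of $\{u\}$, and $\mathscr E_V=\operatorname{lin}\{e_u:u\in V\}$. For $\boldsymbol\lambda=\{\lambda_v\}_{v\in V^\circ}\subseteq\mathbb C$ and $f:V\to\mathbb C$ let $(\Lambda_{\mathcal T}f)(v)=\lambda_v f(\mathsf{par}(v))$ for $v\in V^\circ$ and $(\Lambda_{\mathcal T}f)(\mathsf{root})=0$. The weighted shift $S_{\boldsymbol\lambda}$ on $\mathcal T$ with weights $\boldsymbol\lambda$ is the operator in $\ell^2(V)$ with domain $\mathcal D(S_{\boldsymbol\lambda})=\{f\in\ell^2(V):\Lambda_{\mathcal T}f\in\ell^2(V)\}$ and $S_{\boldsymbol\lambda}f=\Lambda_{\mathcal T}f$. For an operator $A$, $\mathcal D^\infty(A)=\bigcap_{n=0}^\infty\mathcal D(A^n)$. $\mathbb R_+=[0,\infty)$; $\delta_0$ is the Borel probability measure on $\mathbb R_+$ concentrated at $0$. Conventions: $\frac10=\infty$, $0\cdot\infty=0$, a sum over the empty set is $0$; sums and integrals of nonnegative quantities take values in $[0,\infty]$. A densely defined operator $S$ in a complex Hilbert space $\mathcal H$ is subnormal if there exist a complex Hilbert space $\mathcal K\supseteq\mathcal H$ (isometric embedding) and a normal operator $N$ in $\mathcal K$ (closed, densely defined, $N^*N=NN^*$) such that $\mathcal D(S)\subseteq\mathcal D(N)$ and $Sh=Nh$ for all $h\in\mathcal D(S)$. *)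

(* Defs.v *)
From HB Require Import structures.
From mathcomp Require Import all_boot all_order all_algebra.
From mathcomp Require Import all_classical all_reals all_analysis.
From mathcomp.real_closed Require Import complex.
From mathcomp Require Import ring lra.

Set Implicit Arguments.
Unset Strict Implicit.
Unset Printing Implicit Defensive.

Import Order.TTheory GRing.Theory Num.Def Num.Theory.
Import numFieldNormedType.Exports.
Import Normc.

Local Open Scope classical_set_scope.
Local Open Scope complex_scope.
Local Open Scope ring_scope.

(* A complex Hilbert space: a complete normed module over R[i] whose norm comes
   from an inner product, linear in its first argument. *)
HB.mixin Record CompleteNormedModule_isHilbert (R : realType) H
    & CompleteNormedModule R[i] H := {
  inner : {dot H for (conjC : R[i] -> R[i])} ;
  inner_normE : forall x : H, inner x x = `|x| ^+ 2
}.

#[short(type="hilbertType")]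
HB.structure Definition Hilbert (R : realType) :=
  {H of CompleteNormedModule R[i] H & CompleteNormedModule_isHilbert R H}.

Section operators.
Variables (R : realType).
Implicit Types H K : hilbertType R.

(* An (unbounded) operator in H is given by its graph, a functional linear
   subspace of H * H; its domain is the first projection of the graph. *)
Record operator H := Operator {
  graph :> set (H * H) ;
  graph0 : graph 0 ;
  graph_linear : forall (a : R[i]) p q,
    graph p -> graph q -> graph (a *: p + q) ;
  graph_functional : forall x y z, graph (x, y) -> graph (x, z) -> y = z
}.

Definition dom H (A : set (H * H)) : set H := [set x | exists y, A (x, y)].

(* The product B A, with domain {x in D(A) | A x in D(B)}. *)
Definition op_comp H (B A : set (H * H)) : set (H * H) :=
  [set p | exists2 y, A (p.1, y) & B (y, p.2)].

(* [diagonal] is the graph of the identity, so A^0 = I is defined everywhere. *)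
Definition op_pow H (A : set (H * H)) (n : nat) : set (H * H) :=
  iter n (op_comp A) diagonal.

Definition dom_infty H (A : set (H * H)) : set H :=
  \bigcap_n dom (op_pow A n).

(* The adjoint A' as a relation: A' g = h iff <A x, g> = <x, h> for all x in D(A).
   It is functional exactly when A is densely defined. *)
Definition adjoint H (A : set (H * H)) : set (H * H) :=
  [set p | forall x y, A (x, y) -> inner y p.1 = inner x p.2].

Definition normal_operator H (N : operator H) :=
  [/\ dense (dom N), closed (graph N) &
      op_comp (adjoint N) N = op_comp N (adjoint N)].

(* Equality of graphs in [normal_operator] includes equality of domains.  The
   Hilbert space K contains H through the linear isometry J. *)
Definition subnormal H (S : operator H) :=
  dense (dom S) /\
  exists (K : hilbertType R) (J : {linear H -> K}) (N : operator K),
    [/\ forall x, `|J x| = `|x|, normal_operator N &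
        forall x y, graph S (x, y) -> graph N (J x, J y)].

End operators.

(* The linear span of A. *)
Definition lin (K : pzRingType) (U : lmodType K) (A : set U) : set U :=
  [set x | exists n (c : 'I_n -> K) (y : 'I_n -> U),
     (forall i, A (y i)) /\ x = \sum_(i < n) c i *: y i].

Section cauchy_schwarz.
Variables (R : realType) (H : lmodType R[i]).
Variable dot : {dot H for (conjC : R[i] -> R[i])}.

Lemma dot_cauchy_schwarz u v : `|dot u v| ^+ 2 <= dot u u * dot v v.
Proof.
have [->|v0] := eqVneq v 0.
  by rewrite linear0r normr0 expr0n mulr_ge0 ?dnorm_ge0.
have vv_gt0 : 0 < dot v v by exact: neq0_dnorm_gt0.
have := dnorm_ge0 dot (dot v v *: u - dot u v *: v).
rewrite dnormB !dnormZ linearZl_LR linearZr_LR /=.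
have vvE : (dot v v)^* = dot v v by apply/conj_Creal/ger0_real/ltW.
rewrite ger0_norm ?(ltW vv_gt0)//.
rewrite (mulrC (_^*) (dot u v)) -normCK rmorphM /= vvE.
have -> : (`|dot u v| ^+ 2)^* = `|dot u v| ^+ 2.
  by apply/conj_Creal; rewrite rpredX// normr_real.
rewrite opprD addrA [dot v v ^+ 2 * _ + _]addrC -!addrA.
set X := `|dot u v| ^+ 2; set Y := dot v v; set Z := dot u u.
have -> : X * Y + (Y ^+ 2 * Z + (- (Y * X) - Y * X)) = Y * (Z * Y - X).
  by rewrite mulrBr expr2; rewrite [X * Y]mulrC; ring.
by rewrite pmulr_rge0// subr_ge0.
Qed.

Lemma dot_triangle u v :
  sqrtC (dot (u + v) (u + v)) <= sqrtC (dot u u) + sqrtC (dot v v).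
Proof.
rewrite -ler_sqr ?nnegrE ?addr_ge0 ?sqrtC_ge0 ?dnorm_ge0//.
rewrite sqrrD !sqrtCK dnormD [leRHS]addrAC lerD2l.
have -> : dot u v + (dot u v)^* = 'Re (dot u v) *+ 2.
  by rewrite ReE -mulr_natr divfK// pnatr_eq0.
rewrite lerMn2r /=.
apply: (le_trans (leif_Re_Creal (dot u v)).1).
rewrite -ler_sqr ?nnegrE ?mulr_ge0 ?sqrtC_ge0 ?dnorm_ge0//.
by rewrite exprMn !sqrtCK dot_cauchy_schwarz.
Qed.

End cauchy_schwarz.

Section summation.
Variables (R : realType) (V : choiceType).
Implicit Types (a b : V -> R) (z w : V -> R[i]).

(* Unordered sum of an absolutely summable family; [csum] is its complex
   version, computed on real and imaginary parts. *)
Definition rsum a : R :=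
  fine (\esum_(v in setT) (a^\+ v)%:E) - fine (\esum_(v in setT) (a^\- v)%:E).

Definition csum z : R[i] :=
  rsum (fun v => complex.Re (z v)) +i* rsum (fun v => complex.Im (z v)).

Definition absum a := (\esum_(v in setT) `|a v|%:E < +oo)%E.

Lemma absum_le a b : (forall v, `|a v| <= `|b v|) -> absum b -> absum a.
Proof.
by move=> ab; apply: le_lt_trans; apply: le_esum => v _; rewrite lee_fin.
Qed.

Lemma absumD a b : absum a -> absum b -> absum (fun v => a v + b v).
Proof.
move=> ha hb; rewrite /absum.
apply: (@le_lt_trans _ _ (\esum_(v in setT) (`|a v|%:E + `|b v|%:E))%E).
  by apply: le_esum => v _; rewrite -EFinD lee_fin ler_normD.
by rewrite esumD ?lte_add_pinfty// => v _; rewrite lee_fin.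
Qed.

Lemma esumZl a (c : R) : 0 <= c -> (forall v, 0 <= a v) ->
  (\esum_(v in setT) (c * a v)%:E = c%:E * \esum_(v in setT) (a v)%:E)%E.
Proof.
move=> c0 a0; rewrite /esum -ereal_supZl//; last first.
  by apply/set0P; exists (\sum_(v \in set0) (a v)%:E)%E; exists set0 => //;
     exact: fsets_set0.
congr ereal_sup; rewrite image_comp; apply: eq_imagel => A [fA _] /=.
rewrite !fsumEFin// -EFinM; congr EFin.
by rewrite !fsbig_finite//= mulr_sumr.
Qed.

Lemma absumZ a (c : R) : absum a -> absum (fun v => c * a v).
Proof.
move=> ha; rewrite /absum; under eq_esum do rewrite normrM.
rewrite (@esumZl (fun v => `|a v|))//.
by rewrite lte_mul_pinfty.
Qed.

Lemma esum_ge0_fin a : (forall v, 0 <= a v) -> absum a ->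
  \esum_(v in setT) (a v)%:E \is a fin_num.
Proof.
move=> a0 ha; rewrite ge0_fin_numE ?esum_ge0// => [|v _]; last by rewrite lee_fin.
apply: le_lt_trans ha; apply: le_esum => v _; rewrite lee_fin.
exact: ler_norm.
Qed.

Definition psum a : R := fine (\esum_(v in setT) (a v)%:E).

Lemma psumD a b : (forall v, 0 <= a v) -> (forall v, 0 <= b v) ->
  absum a -> absum b -> psum (fun v => a v + b v) = psum a + psum b.
Proof.
move=> a0 b0 ha hb; rewrite /psum; under eq_esum do rewrite EFinD.
rewrite esumD; [|by move=> v _; rewrite lee_fin..].
by rewrite fineD// esum_ge0_fin.
Qed.

Lemma absum_pos a : absum a -> absum a^\+.
Proof.
apply: absum_le => v; rewrite ger0_norm ?funrpos_ge0//.
by rewrite /funrpos ge_max ler_norm normr_ge0.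
Qed.

Lemma absum_neg a : absum a -> absum a^\-.
Proof.
apply: absum_le => v; rewrite ger0_norm ?funrneg_ge0//.
by rewrite /funrneg ge_max normr_ge0 -normrN ler_norm.
Qed.

Lemma rsumD a b : absum a -> absum b ->
  rsum (fun v => a v + b v) = rsum a + rsum b.
Proof.
move=> ha hb; pose ab v := a v + b v.
have hab : absum ab by exact: absumD.
rewrite /rsum -!/(psum _) -/ab.
have : psum (fun v => (a^\+ v + b^\+ v) + ab^\- v) =
       psum (fun v => (a^\- v + b^\- v) + ab^\+ v).
  congr fine; apply: eq_esum => v _; congr EFin.
  have posE (c : V -> R) : c^\+ v = c v + c^\- v.
    by rewrite -[in c v](funrposBneg c) /= !fctE subrK.
  by rewrite !posE -!/(ab v) /ab addrACA [RHS]addrA [a v + b v + _]addrC.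
have [hap han] := (absum_pos ha, absum_neg ha).
have [hbp hbn] := (absum_pos hb, absum_neg hb).
have [hp hn] := (absum_pos hab, absum_neg hab).
rewrite (psumD (a := fun v => a^\+ v + b^\+ v) (b := ab^\-)) =>
  [|v|v||]; [|by rewrite ?addr_ge0|by []|exact: absumD|by []].
rewrite (psumD (a := fun v => a^\- v + b^\- v) (b := ab^\+)) =>
  [|v|v||]; [|by rewrite ?addr_ge0|by []|exact: absumD|by []].
rewrite (psumD (a := a^\+) (b := b^\+))// (psumD (a := a^\-) (b := b^\-))//.
set A := psum a^\+; set A' := psum a^\-; set B := psum b^\+; set B' := psum b^\-.
set P := psum ab^\+; set N := psum ab^\- => e.
have -> : P = A + B + N - (A' + B') by rewrite e addrC addKr.
by rewrite opprD; ring.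
Qed.

Lemma rsumN a : rsum (fun v => - a v) = - rsum a.
Proof.
rewrite /rsum -[X in X^\+]/(\- a) -[X in X^\-]/(\- a) funrposN funrnegN.
by rewrite opprB.
Qed.

Lemma rsumZ a (c : R) : absum a -> rsum (fun v => c * a v) = c * rsum a.
Proof.
move=> ha.
wlog c0 : c / 0 <= c => [H|].
  have [/H//|c0] := leP 0 c.
  have := H (- c); rewrite oppr_ge0 ltW// => /(_ isT).
  under eq_fun do rewrite mulNr.
  by rewrite rsumN mulNr => /oppr_inj.
rewrite /rsum (ge0_funrposM _ c0) (ge0_funrnegM _ c0).
rewrite !esumZl// !fineM// ?esum_ge0_fin//;
  do ?[exact: absum_pos|exact: absum_neg].
by rewrite mulrBr.
Qed.

End summation.

Section l2_space.
Variables (R : realType) (V : choiceType).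
Local Notation C := R[i].
Implicit Types (z w : C).

Lemma nsqE z : normc z ^+ 2 = complex.Re z ^+ 2 + complex.Im z ^+ 2.
Proof. by case: z => x y /=; rewrite sqr_sqrtr// addr_ge0 ?sqr_ge0. Qed.

Lemma mul_conjE z : z * z^* = (normc z ^+ 2)%:C.
Proof.
rewrite nsqE; case: z => x y; apply/eqP; rewrite eq_complex /=.
by apply/andP; split; apply/eqP; ring.
Qed.

(* [normc] is the modulus as an element of R, whereas [`|z|] lives in R[i]. *)
Definition sqsummable : {pred V -> C} :=
  fun f => (\esum_(v in setT) (normc (f v) ^+ 2)%:E < +oo)%E.

Lemma absum_nsq (f : V -> C) :
  f \in sqsummable <-> absum (fun v => normc (f v) ^+ 2).
Proof.
rewrite /absum unfold_in.
by under [X in _ <-> (X < _)%E]eq_esum do rewrite ger0_norm ?sqr_ge0//.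
Qed.

Lemma sqsummable_submod_closed : submod_closed sqsummable.
Proof.
split => [|a f g /absum_nsq hf /absum_nsq hg].
  apply/absum_nsq; rewrite /absum esum1 ?ltry// => v _.
  by rewrite -[(0 : V -> C) v]/(0 : C) normc0 expr0n normr0.
apply/absum_nsq.
apply: (@absum_le _ _ _ (fun v => 2 * normc a ^+ 2 * normc (f v) ^+ 2 +
    2 * normc (g v) ^+ 2)); last by apply: absumD; apply: absumZ.
move=> v; rewrite [leLHS]ger0_norm ?sqr_ge0// (le_trans _ (ler_norm _))//.
rewrite -mulrA -exprMn -normcM -[(a *: f + g) v]/(a * f v + g v).
set z := a * f v; set w := g v; rewrite !nsqE !raddfD /=.
have := sqr_ge0 (complex.Re z - complex.Re w).
have := sqr_ge0 (complex.Im z - complex.Im w).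
by rewrite !expr2 => *; lra.
Qed.

HB.instance Definition _ :=
  GRing.isSubmodClosed.Build _ _ sqsummable sqsummable_submod_closed.

Record l2 := L2 { l2_fun :> V -> C; l2_sqsummable : l2_fun \in sqsummable }.

HB.instance Definition _ := [isSub for l2_fun].
HB.instance Definition _ := [Choice of l2 by <:].
HB.instance Definition _ := [SubChoice_isSubLmodule of l2 by <:].

Definition l2_dot (f g : l2) : C := csum (fun v => f v * (g v)^*).

Lemma absum_dot (f g : l2) :
  absum (fun v => complex.Re (f v * (g v)^*)) /\
  absum (fun v => complex.Im (f v * (g v)^*)).
Proof.
have /absum_nsq hf := l2_sqsummable f.
have /absum_nsq hg := l2_sqsummable g.
have h := absumD hf hg.
split; apply: absum_le h => v.
  rewrite [leRHS]ger0_norm ?addr_ge0 ?sqr_ge0// !nsqE.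
  case: (f v) (g v) => [x y] [x' y'] /=.
  have := sqr_ge0 (x - x'); have := sqr_ge0 (y - y').
  have := sqr_ge0 (x + x'); have := sqr_ge0 (y + y').
  by rewrite !expr2 ler_norml => *; apply/andP; split; lra.
rewrite [leRHS]ger0_norm ?addr_ge0 ?sqr_ge0// !nsqE.
case: (f v) (g v) => [x y] [x' y'] /=.
have := sqr_ge0 (x - y'); have := sqr_ge0 (y - x').
have := sqr_ge0 (x + y'); have := sqr_ge0 (y + x').
by rewrite !expr2 ler_norml => *; apply/andP; split; lra.
Qed.

Lemma l2_dotC (f g : l2) : l2_dot f g = (l2_dot g f)^*.
Proof.
apply/eqP; rewrite eq_complex /=; apply/andP; split; apply/eqP.
  congr rsum; apply/funext => v; case: (f v) (g v) => [x y] [x' y'] /=; ring.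
rewrite -rsumN; congr rsum; apply/funext => v.
by case: (f v) (g v) => [x y] [x' y'] /=; ring.
Qed.

Lemma l2_dot_linearl (g : l2) : linear_for *%R (l2_dot ^~ g).
Proof.
move=> a f h; have [hfr hfi] := absum_dot f g; have [hhr hhi] := absum_dot h g.
have hp (c d : R) : absum (fun v => c * complex.Re (f v * (g v)^*) +
    d * complex.Im (f v * (g v)^*)) by apply: absumD; apply: absumZ.
have reE : (fun v => complex.Re ((a *: f + h) v * (g v)^*)) =
   fun v => (complex.Re a * complex.Re (f v * (g v)^*) +
    - complex.Im a * complex.Im (f v * (g v)^*)) + complex.Re (h v * (g v)^*).
  apply/funext => v; rewrite -[(a *: f + h) v]/(a * f v + h v).
  by move: (a) (f v) (h v) (g v) => [? ?] [? ?] [? ?] [? ?] /=; ring.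
have imE : (fun v => complex.Im ((a *: f + h) v * (g v)^*)) =
   fun v => (complex.Im a * complex.Re (f v * (g v)^*) +
    complex.Re a * complex.Im (f v * (g v)^*)) + complex.Im (h v * (g v)^*).
  apply/funext => v; rewrite -[(a *: f + h) v]/(a * f v + h v).
  by move: (a) (f v) (h v) (g v) => [? ?] [? ?] [? ?] [? ?] /=; ring.
rewrite /l2_dot /csum reE imE !(rsumD (hp _ _))//.
rewrite !(rsumD (absumZ _ _) (absumZ _ _))// !rsumZ//.
clear reE imE; case: a => x y; apply/eqP; rewrite eq_complex /=.
by apply/andP; split; apply/eqP; ring.
Qed.

Lemma l2_dot_linearr (f : l2) : linear_for (conjC \; *%R) (l2_dot f).
Proof.
move=> a g h; rewrite /= l2_dotC l2_dot_linearl rmorphD rmorphM /=.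
by rewrite -!(l2_dotC f).
Qed.

HB.instance Definition _ := bilinear_isBilinear.Build C l2 l2 C
  *%R (conjC \; *%R) l2_dot (l2_dot_linearl, l2_dot_linearr).

Lemma l2_dot_hermitian (f g : l2) : l2_dot f g = (-1) ^+ false * (l2_dot g f)^*.
Proof. by rewrite mul1r l2_dotC. Qed.

HB.instance Definition _ :=
  isHermitianSesquilinear.Build C l2 false conjC l2_dot l2_dot_hermitian.

Definition l2_nsq (f : l2) : R := psum (fun v => normc (f v) ^+ 2).

Lemma l2_dotE (f : l2) : l2_dot f f = (l2_nsq f)%:C.
Proof.
have reE : (fun v => complex.Re (f v * (f v)^*)) = fun v => normc (f v) ^+ 2.
  by apply/funext => v; rewrite mul_conjE.
have imE : (fun v => complex.Im (f v * (f v)^*)) = fun=> 0.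
  by apply/funext => v; rewrite mul_conjE.
rewrite /l2_dot /csum reE imE /rsum; apply/eqP; rewrite eq_complex /=.
apply/andP; split; apply/eqP.
  rewrite [X in _ - fine X]esum1 => [|v _]; last first.
    by rewrite /funrneg max_r// oppr_le0 sqr_ge0.
  rewrite subr0; congr fine; apply: eq_esum => v _.
  by rewrite /funrpos max_l// sqr_ge0.
rewrite !esum1 ?subrr// => v _; first by rewrite /funrneg oppr0 maxxx.
by rewrite /funrpos maxxx.
Qed.

Lemma le_l2_nsq (f : l2) (A : set V) : finite_set A ->
  \sum_(v \in A) normc (f v) ^+ 2 <= l2_nsq f.
Proof.
move=> fA; have /absum_nsq hf := l2_sqsummable f.
rewrite -lee_fin -fsumEFin// fineK; last first.
  by apply: esum_ge0_fin => // v; exact: sqr_ge0.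
by apply: ereal_sup_ubound; exists A.
Qed.

Lemma le_l2_nsq1 (f : l2) v : normc (f v) ^+ 2 <= l2_nsq f.
Proof. by have := le_l2_nsq f (finite_set1 v); rewrite fsbig_set1. Qed.

Lemma l2_dot_gt0 (f : l2) : f != 0 -> 0 < l2_dot f f.
Proof.
move=> f0; rewrite l2_dotE ltcR.
have [v fv0] : exists v, f v != 0.
  apply: contrapT => f0'; move/eqP: f0; apply; apply/val_inj/funext => v /=.
  by apply/eqP/negPn/negP => fv0; apply: f0'; exists v.
apply: lt_le_trans (le_l2_nsq1 f v); rewrite lt0r sqr_ge0 andbT sqrf_eq0.
by apply: contra fv0 => /eqP/eq0_normc/eqP.
Qed.

HB.instance Definition _ := isDotProduct.Build C l2 l2_dot l2_dot_gt0.

Definition l2_inner : {dot l2 for conjC} := l2_dot.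

Definition l2_norm (f : l2) : C := sqrtC (l2_dot f f).

Lemma l2_normD (f g : l2) : l2_norm (f + g) <= l2_norm f + l2_norm g.
Proof. exact: (dot_triangle l2_inner). Qed.

Lemma l2_normZ (a : C) (f : l2) : l2_norm (a *: f) = `|a| * l2_norm f.
Proof.
rewrite /l2_norm (dnormZ l2_inner) sqrtCM ?nnegrE;
  do ?[exact: (dnorm_ge0 l2_inner)|exact: exprn_ge0].
by rewrite sqrCK.
Qed.

Lemma l2_norm_eq0 (f : l2) : l2_norm f = 0 -> f = 0.
Proof. by move=> /eqP; rewrite (sqrt_dnorm_eq0 l2_inner) => /eqP. Qed.

HB.instance Definition _ :=
  Lmodule_isNormed.Build C l2 l2_normD l2_normZ l2_norm_eq0.

Lemma l2_normE (f : l2) : `|f| ^+ 2 = (l2_nsq f)%:C.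
Proof. by rewrite -[LHS]/(l2_norm f ^+ 2) sqrtCK l2_dotE. Qed.

Lemma lt0cR (x : R) : (0 < x%:C) = (0 < x).
Proof. by rewrite -[0]/(0%:C) ltcR. Qed.

Lemma le_normE (f : l2) (e : R) : 0 <= e ->
  (`|f| <= e%:C) = (l2_nsq f <= e ^+ 2).
Proof.
move=> e0; rewrite -ler_sqr ?nnegrE ?ler0c// l2_normE -[_ ^+ 2 in LHS]rmorphXn.
by rewrite lecR.
Qed.

Lemma l2_complete (F : set_system l2) : ProperFilter F -> cauchy F -> cvg F.
Proof.
move=> FF /cauchyP Fc.
have ballE (f g : l2) (e : C) : ball f e g = (`|f - g| < e) by [].
pose re v (f : l2) : R := complex.Re (f v).
pose im v (f : l2) : R := complex.Im (f v).
have cvg_coord (phi : l2 -> R) :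
    (forall f g, (phi f - phi g) ^+ 2 <= l2_nsq (f - g)) ->
    cvg (phi f @[f --> F]).
  move=> phiP; apply: R_complete; apply/cauchy_exP => e e0.
  have [|f Ff] := Fc (e / 2)%:C; first by rewrite lt0cR divr_gt0.
  exists (phi f); suff: F [set g | ball (phi f) e (phi g)] by [].
  apply: filterS Ff => g; rewrite -!ball_normE /= => fg.
  apply: (@le_lt_trans _ _ (e / 2)); last by rewrite gtr_pMr// invf_lt1 ?ltr1n.
  rewrite -ler_sqr ?nnegrE ?divr_ge0 ?(ltW e0)// real_normK ?num_real//.
  apply: (le_trans (phiP f g)); rewrite -le_normE ?ltW ?divr_gt0//.
have cvgRe v : cvg (re v f @[f --> F]).
  apply: cvg_coord => f g; apply: le_trans (le_l2_nsq1 (f - g) v).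
  rewrite nsqE -[l2_fun (f - g) v]/(f v - g v) !raddfB /=.
  by rewrite lerDl sqr_ge0.
have cvgIm v : cvg (im v f @[f --> F]).
  apply: cvg_coord => f g; apply: le_trans (le_l2_nsq1 (f - g) v).
  rewrite nsqE -[l2_fun (f - g) v]/(f v - g v) !raddfB /=.
  by rewrite lerDr sqr_ge0.
pose l v : C := lim (re v f @[f --> F]) +i*
                lim (im v f @[f --> F]).
have fl (f : l2) (e : R) : 0 < e -> F (ball f e%:C) ->
    (\esum_(v in setT) (normc (f v - l v) ^+ 2)%:E <= (e ^+ 2)%:E)%E.
  move=> e0 Ff; apply: ge_ereal_sup => _ [A [fA _] <-].
  rewrite fsumEFin// lee_fin.
  pose S (g : l2) : R := \sum_(v \in A) normc (f v - g v) ^+ 2.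
  have cv : S g @[g --> F] --> \sum_(v \in A) normc (f v - l v) ^+ 2.
    rewrite /S fsbig_finite//=; under eq_fun do rewrite fsbig_finite//=.
    apply: cvg_big => [|v _]; first exact: add_continuous.
    under eq_fun do rewrite nsqE !raddfB /=.
    rewrite nsqE !raddfB /=.
    have cRe := cvgB (cvg_cst (re v f)) (cvgRe v).
    have cIm := cvgB (cvg_cst (im v f)) (cvgIm v).
    apply: cvgD; first exact: (cvgM (cRe _ _) (cRe _ _)).
    exact: (cvgM (cIm _ _) (cIm _ _)).
  rewrite -(cvg_lim _ cv)//; apply: limr_le.
    by apply/cvg_ex; eexists; exact: cv.
  apply: filterS Ff => g; rewrite ballE => /ltW.
  rewrite le_normE ?(ltW e0)//; apply: le_trans.
  exact: (le_l2_nsq (f - g) fA).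
have lP : l \in sqsummable.
  have [|f Ff] := Fc 1%:C; first by rewrite lt0cR.
  have h : (f : V -> C) - l \in sqsummable.
    by rewrite unfold_in; apply: le_lt_trans (fl f 1 ltr01 Ff) (ltry _).
  have -> : l = (f : V -> C) - ((f : V -> C) - l) by rewrite opprB addrC subrK.
  by apply: rpredB => //; exact: l2_sqsummable.
pose L := L2 lP.
have split_pos (e : C) : 0 < e -> exists2 r : R, 0 < r & e = (r + r)%:C.
  case: e => x y; rewrite ltcE => /andP[/eqP y0 x0].
  rewrite -[y]/(complex.Im (x +i* y)) y0.
  have x1 : 0 < x := x0.
  by exists (x / 2 : R); [rewrite divr_gt0|rewrite -splitr].
apply/cvg_ex; exists L; apply/cvgrPdist_lt => e /split_pos[r r0 ->].
have [|f Ff] := Fc r%:C; first by rewrite lt0cR.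
apply: filterS (Ff) => g; rewrite ballE => fg.
have -> : L - g = (L - f) + (f - g) by rewrite addrA subrK.
apply: le_lt_trans (ler_normD _ _) _; rewrite rmorphD ler_ltD//.
rewrite distrC le_normE ?(ltW r0)//.
have h := fl f r r0 Ff.
rewrite -lee_fin fineK//; apply: esum_ge0_fin => [v|]; first exact: sqr_ge0.
exact: ((absum_nsq (f - L)).1 (l2_sqsummable (f - L))).
Qed.

HB.instance Definition _ := Uniform_isComplete.Build l2 l2_complete.

HB.instance Definition _ := CompleteNormedModule_isHilbert.Build R l2
  (fun f : l2 => esym (sqrtCK (l2_inner f f))).

End l2_space.

Lemma delta_sqsummable (R : realType) (V : choiceType) (u : V) :
  (fun v => (v == u)%:R : R[i]) \in sqsummable (R := R) (V := V).
Proof.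
rewrite unfold_in (_ : esum _ _ = \esum_(v in [set u]) 1%:E)%E.
  by rewrite esum_set1 ?ltry// lee_fin.
rewrite [RHS]esum_mkcond; apply: eq_esum => v _; rewrite in_set1.
by case: eqP => _; rewrite ?normc1 ?normc0 ?expr1n ?expr0n.
Qed.

Definition l2_delta (R : realType) (V : choiceType) (u : V) : l2 R V :=
  L2 (delta_sqsummable R u).

Record directed_tree (V : choiceType) := DirectedTree {
  edge : rel V ;
  tree_nonempty : [set: V] !=set0 ;
  edge_irreflexive : irreflexive edge ;
  tree_connected : forall u v : V,
    exists2 p, path (fun x y => edge x y || edge y x) u p & last u p = v ;
  tree_no_circuit : forall c : seq V,
    (2 <= size c)%N -> uniq c -> ~~ cycle edge c ;
  tree_parent_unique : forall u u' v, edge u v -> edge u' v -> u = u'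
}.

Section weighted_shift.
Variables (R : realType) (V : choiceType) (T : directed_tree V).

Definition is_root (v : V) : Prop := forall u, ~~ edge T u v.

Definition nonroots : set V := [set v | ~ is_root v].

Definition children (u : V) : set V := [set v | edge T u v].

(* The default value v is only taken at the root, where [parent] is not used. *)
Definition parent (v : V) : V := xget v [set u | edge T u v].

(* The weights are indexed by all of V for convenience; the value at the root, if
   there is one, is irrelevant. *)
Variable lambda : V -> R[i].

Definition Lambda (f : V -> R[i]) (v : V) : R[i] :=
  if v \in nonroots then lambda v * f (parent v) else 0.

(* The pairs (f, g) of l^2(V) with g = Lambda f: the domain condition
   "Lambda f is square summable" is carried by the type of g. *)
Definition wshift_graph : set (l2 R V * l2 R V) :=
  [set p : l2 R V * l2 R V | forall v, p.2 v = Lambda p.1 v].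

Lemma wshift_graph0 : wshift_graph 0.
Proof.
move=> v; rewrite /Lambda -[(0 : l2 R V * l2 R V).2 v]/(0 : R[i]).
by rewrite -[X in _ * X]/(0 : R[i]) mulr0 if_same.
Qed.

Lemma wshift_graph_linear (a : R[i]) p q :
  wshift_graph p -> wshift_graph q -> wshift_graph (a *: p + q).
Proof.
move=> hp hq v; rewrite -[LHS]/(a * p.2 v + q.2 v) hp hq /Lambda.
case: ifP => _; last by rewrite mulr0 addr0.
rewrite -[X in _ = _ * X]/(a * p.1 (parent v) + q.1 (parent v)).
by rewrite mulrDr mulrCA.
Qed.

Lemma wshift_graph_functional f g h :
  wshift_graph (f, g) -> wshift_graph (f, h) -> g = h.
Proof. by move=> fg fh; apply/val_inj/funext => v; rewrite /= fg fh. Qed.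

Definition wshift : operator (l2 R V) :=
  Operator wshift_graph0 wshift_graph_linear wshift_graph_functional.

End weighted_shift.

(* Main.v *)
(* Let K1 = L^2(V x R) for the measure whose slice over {v} is mu_v.  On K1 let
   (A F)(v, s) = lambda_v F(par v, s); f |-> ((v, s) |-> f v) embeds l^2(V)
   isometrically and intertwines S_lambda with A.  Consistency says that A = U M,
   where M is multiplication by sqrt s and U, given for s > 0 by
   (U F)(v, s) = lambda_v s^(-1/2) F(par v, s) and by the identity for s <= 0, is
   an isometry commuting with M: A is quasinormal.  A unitary dilation W of U on
   K1 (+) K1 which commutes with M (+) M makes W (M (+) M) a normal extension of A.
   The unbounded M is only used through the bounded injective operator
   B = (1 + M)^-1, multiplication by 1 / (1 + sqrt s); the adjoint of U comes from
   projecting on the closed range of U. *)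
Require Import Defs.
From HB Require Import structures.
From mathcomp Require Import all_boot all_order all_algebra.
From mathcomp Require Import all_classical all_reals all_analysis.
From mathcomp Require Import measurable_realfun.
From mathcomp.real_closed Require Import complex.
From mathcomp Require Import ring lra.
Import Order.TTheory GRing.Theory Num.Theory.
Import numFieldNormedType.Exports.
Local Open Scope classical_set_scope.
Local Open Scope ring_scope.

Set Implicit Arguments.
Unset Strict Implicit.
Unset Printing Implicit Defensive.

(** * Hilbert spaces *)

(** [M] is the modulus of [A]: by consistency the squared norm of [A F] is the integral of s |F|^2,
    hence the square root. Since [M] acts in the same way on all fibres and the shift moves values
    between fibres at a fixed s, the phase commutes with [M]. The obstacle is the point s = 0, where
    the Dirac terms live. There [M] vanishes, so the polar phase of [A] has a kernel, whereas a
    unitary [W] with W (x, 0) = (U x, 0) forces [U] to be isometric. But U M depends on [U] only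
    through the range of [M], so [U] may be redefined over s <= 0; the identity is a choice that
    makes it isometric and keeps it commuting with [M]. The intertwining must also survive at s = 0,
    where U M gives 0 while the embedded S f is constant along each fibre. It does, because 1/0 = oo
    turns the consistency condition at {0} into a prohibition: [mu v] has no atom at 0 if v has a
    parent and lambda_v is nonzero, and S f vanishes at every other v. *)

Section hilbert.
Context {R : realType}.
Local Notation C := R[i].
Local Open Scope complex_scope.
Implicit Types H K : hilbertType R.

(** Estimates use this real number because the norm itself takes values in [R[i]], where the order
    is partial. *)
Definition hnsq H (x : H) : R := complex.Re (inner x x).

Lemma innerDl H (x y z : H) : inner (x + y) z = inner x z + inner y z.
Proof. exact: linearDl. Qed.

Lemma innerDr H (x y z : H) : inner x (y + z) = inner x y + inner x z.
Proof. exact: linearDr. Qed.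

Lemma innerNl H (x y : H) : inner (- x) y = - inner x y.
Proof. exact: linearNl. Qed.

Lemma innerNr H (x y : H) : inner x (- y) = - inner x y.
Proof. exact: linearNr. Qed.

Lemma innerBl H (x y z : H) : inner (x - y) z = inner x z - inner y z.
Proof. by rewrite innerDl innerNl. Qed.

Lemma innerBr H (x y z : H) : inner x (y - z) = inner x y - inner x z.
Proof. by rewrite innerDr innerNr. Qed.

Lemma innerZl H (a : C) (x y : H) : inner (a *: x) y = a * inner x y.
Proof. exact: linearZl_LR. Qed.

Lemma innerZr H (a : C) (x y : H) : inner x (a *: y) = a^* * inner x y.
Proof. exact: linearZr_LR. Qed.

Lemma inner0l H (x : H) : inner 0 x = 0.
Proof. exact: linear0l. Qed.

Lemma inner0r H (x : H) : inner x 0 = 0.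
Proof. exact: linear0r. Qed.

Lemma innerC H (x y : H) : inner x y = (inner y x)^*.
Proof. by rewrite hermC expr0 mul1r. Qed.

Lemma inner_hnsq H (x : H) : inner x x = (hnsq x)%:C.
Proof.
have : 0 <= inner x x by rewrite inner_normE exprn_ge0.
by rewrite /hnsq; case: (inner x x) => a b; rewrite lecE /= => /andP[/eqP -> _].
Qed.

Lemma hnsq_ge0 H (x : H) : 0 <= hnsq x.
Proof. by rewrite -ler0c -inner_hnsq inner_normE exprn_ge0. Qed.

Lemma hnsq_eq0 H (x : H) : hnsq x = 0 -> x = 0.
Proof.
move=> x0; apply/eqP; rewrite -normr_eq0 -sqrf_eq0 -inner_normE inner_hnsq x0.
by [].
Qed.

Lemma normr_lt_hnsq H (x : H) (e : R) : 0 < e ->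
  (`|x| < e%:C) = (hnsq x < e ^+ 2).
Proof.
move=> e0; rewrite -ltr_sqr ?nnegrE// ?ler0c ?(ltW e0)//.
by rewrite -inner_normE inner_hnsq -rmorphXn ltcR.
Qed.

Lemma hnsq_normr H K (x : H) (y : K) : hnsq x = hnsq y -> `|x| = `|y|.
Proof.
move=> xy; apply/eqP; rewrite -(@eqrXn2 _ 2)//.
by rewrite -!inner_normE !inner_hnsq xy.
Qed.

Lemma hnsqZ H (a : C) (x : H) : hnsq (a *: x) = Normc.normc a ^+ 2 * hnsq x.
Proof.
apply: (@complexI R); rewrite -inner_hnsq innerZl innerZr mulrA.
by rewrite mul_conjE inner_hnsq -rmorphM.
Qed.

Lemma hnsqN H (x : H) : hnsq (- x) = hnsq x.
Proof. by rewrite /hnsq innerNl innerNr opprK. Qed.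

Lemma hnsqBC H (x y : H) : hnsq (x - y) = hnsq (y - x).
Proof. by rewrite -hnsqN opprB. Qed.

Lemma hnsqD H (x y : H) :
  hnsq (x + y) = hnsq x + hnsq y + 2 * complex.Re (inner x y).
Proof.
rewrite /hnsq innerDl !innerDr (innerC y x).
by move: (inner x x) (inner x y) (inner y y) => [? ?] [? ?] [? ?] /=; ring.
Qed.

Lemma parallelogram H (x y : H) :
  hnsq (x + y) + hnsq (x - y) = 2 * (hnsq x + hnsq y).
Proof. by rewrite !hnsqD hnsqN innerNr raddfN /=; ring. Qed.

Lemma hnsqD_le H (x y : H) : hnsq (x + y) <= 2 * (hnsq x + hnsq y).
Proof. by rewrite -parallelogram lerDl hnsq_ge0. Qed.

Lemma hnsqB_le H (x y z : H) :
  hnsq (x - z) <= 2 * (hnsq (x - y) + hnsq (y - z)).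
Proof. by rewrite -[x - z](subrKA y); exact: hnsqD_le. Qed.

Lemma hilbert_cauchy_schwarz H (x y : H) :
  Normc.normc (inner x y) ^+ 2 <= hnsq x * hnsq y.
Proof.
have := dot_cauchy_schwarz inner x y.
by rewrite !inner_hnsq -rmorphM /= -lecR rmorphXn.
Qed.

Lemma eq0_innerl H (x : H) : (forall y, inner y x = 0) -> x = 0.
Proof. by move=> /(_ x) xx; apply: hnsq_eq0; rewrite /hnsq xx. Qed.

Lemma inner_ext H (x y : H) : (forall z, inner z x = inner z y) -> x = y.
Proof.
move=> xy; apply/eqP; rewrite -subr_eq0; apply/eqP/eq0_innerl => z.
by rewrite innerBr xy subrr.
Qed.

Lemma hilbert_complete H (u : nat -> H) :
  (forall e : R, 0 < e -> exists N, forall n m, (N <= n)%N -> (N <= m)%N ->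
    hnsq (u n - u m) < e) ->
  exists l, forall e : R, 0 < e -> exists N, forall n, (N <= n)%N ->
    hnsq (u n - l) < e.
Proof.
move=> uC.
(* Positivity in [R[i]] includes a zero imaginary part, so the radii of balls are real. *)
have pos (e : C) : 0 < e -> exists2 r : R, 0 < r & e = r%:C.
  case: e => x y; rewrite ltcE => /andP[/= /eqP -> x0]; by exists x.
have : cvg (u @ \oo).
  apply: cauchy_cvg; apply/cauchy_exP => e /pos[r r0 ->].
  have [N uN] := uC _ (exprn_gt0 2 r0).
  exists (u N); exists N => // n /= Nn; rewrite -ball_normE /=.
  by rewrite normr_lt_hnsq// uN.
move=> /cvg_ex[l ul]; exists l => e e0.
have s0 : 0 < Num.sqrt e by rewrite sqrtr_gt0.
have /cvgrPdist_lt/(_ (Num.sqrt e)%:C) := ul.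
rewrite lt0cR => /(_ s0)[N _ uN]; exists N => n Nn.
by have := uN n Nn; rewrite normr_lt_hnsq// sqr_sqrtr ?ltW// hnsqBC.
Qed.

Lemma dense_hnsq H (A : set H) :
  (forall x (e : R), 0 < e -> exists2 a, A a & hnsq (a - x) < e) -> dense A.
Proof.
move=> Ad O [x Ox] oO; have /nbhs_ballP[e /= + eO] := open_nbhs_nbhs (conj oO Ox).
case: e eO => r i eO; rewrite ltcE /= => /andP[/eqP i0 r0]; subst i.
have [a Aa ax] := Ad x _ (exprn_gt0 2 r0); exists a; split => //; apply: eO.
by rewrite -ball_normE /= normr_lt_hnsq// hnsqBC.
Qed.

Lemma normc_sqD_le (z w : C) :
  Normc.normc (z + w) ^+ 2 <= 2 * (Normc.normc z ^+ 2 + Normc.normc w ^+ 2).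
Proof.
rewrite !nsqE; case: z w => [a b] [c d] /=.
by have := sqr_ge0 (a - c); have := sqr_ge0 (b - d); rewrite !expr2 => *; lra.
Qed.

Lemma normc_sq_eq0 (z : C) : Normc.normc z ^+ 2 = 0 -> z = 0.
Proof. by move=> /eqP; rewrite sqrf_eq0 => /eqP /Normc.eq0_normc. Qed.

Lemma normc_sq_gt0 (z : C) : z != 0 -> 0 < Normc.normc z ^+ 2.
Proof.
move=> z0; rewrite lt0r sqr_ge0 andbT; apply: contra z0.
by move=> /eqP/normc_sq_eq0 ->.
Qed.

Lemma le0_small (a : R) : (forall e : R, 0 < e -> a <= e) -> a <= 0.
Proof. by move=> ae; apply/ler_addgt0Pr => e e0; rewrite add0r ae. Qed.

Lemma harmonic_lt (e : R) :
  0 < e -> exists N, forall n, (N <= n)%N -> n.+1%:R^-1 < e.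
Proof.
move=> e0; have /cvgrPdist_lt/(_ _ e0)[N _ Ne] := @cvg_harmonic R.
by exists N => n /Ne; rewrite sub0r normrN ger0_norm// harmonic_ge0.
Qed.

(** As [D] need not be closed, [p] lies in its closure: it is the limit of a minimizing sequence.
    Orthogonality holds up to an error at the members of [D] and becomes exact in the limit. *)
Lemma hilbert_projection H (D : set H) (y : H) : D 0 ->
  (forall (a : C) x z, D x -> D z -> D (a *: x + z)) ->
  exists p, (forall e : R, 0 < e -> exists2 d, D d & hnsq (d - p) < e) /\
            (forall x, D x -> inner (y - p) x = 0).
Proof.
move=> D0 DL; pose S := [set hnsq (y - d) | d in D]; pose delta := inf S.
have SlS : has_inf S.
  split; first by exists (hnsq (y - 0)); exists 0.
  by exists 0 => _ [d _ <-]; exact: hnsq_ge0.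
have deltaP d : D d -> delta <= hnsq (y - d).
  by move=> Dd; apply: ge_inf; [exact: SlS.2|exists d].
have /choice[d dP] n : exists d, D d /\ hnsq (y - d) < delta + n.+1%:R^-1.
  have [|_ [d Dd <-] dn] := @inf_adherent _ S n.+1%:R^-1 _ SlS.
    by rewrite invr_gt0.
  by exists d.
clearbody delta.
(* Parallelogram law for [y - d n] and [y - d m]: the midpoint of [d n] and [d m] lies in [D], so
   its squared distance to [y] is at least [delta]. *)
have diff n m : hnsq (d n - d m) < 2 * (n.+1%:R^-1 + m.+1%:R^-1).
  have [[Dn dn] [Dm dm]] := (dP n, dP m).
  have := parallelogram (y - d n) (y - d m).
  have -> : y - d n - (y - d m) = d m - d n.
    by rewrite opprB [d m - y]addrC addrACA subrr add0r addrC.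
  have -> : y - d n + (y - d m) = 2 *: (y - 2^-1 *: (d n + d m)).
    rewrite scalerBr scalerA mulfV ?pnatr_eq0// scale1r.
    by rewrite addrACA -opprD scaler_nat mulr2n.
  have Dnm : D (2^-1 *: (d n + d m)).
    by rewrite -[_ *: _]addr0; apply: (DL) => //; rewrite -[d n]scale1r; apply: DL.
  rewrite hnsqZ nsqE /= addr0 (hnsqBC (d m)) (expr0n _ 2) addr0 /=.
  have := deltaP _ Dnm.
  set q := hnsq (y - _); set q' := hnsq (d n - d m).
  move: dn dm; set a := n.+1%:R^-1; set b := m.+1%:R^-1.
  have -> : (1 + 1) ^+ 2 = 4 :> R by ring.
  by move=> hn km dq; lra.
have [p pP] : exists l, forall e : R, 0 < e -> exists N, forall n, (N <= n)%N ->
    hnsq (d n - l) < e.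
  apply: hilbert_complete => e e0; have [N Ne] := @harmonic_lt (e / 4) ltac:(lra).
  exists N => n m /Ne + /Ne.
  have := diff n m; set a := n.+1%:R^-1; set b := m.+1%:R^-1 => *; lra.
exists p; split=> [e e0|x Dx].
  by have [N /(_ _ (leqnn N))] := pP e e0; exists (d N); first exact: (dP N).1.
(* Moving from [z] to the best point on the line through [z] along [x] lowers the squared distance
   by |<y - z, x>|^2 / |x|^2, which cannot exceed the excess over [delta]. *)
have ort z : D z ->
    Normc.normc (inner (y - z) x) ^+ 2 <= (hnsq (y - z) - delta) * hnsq x.
  move=> Dz; have [x0|x0] := eqVneq (hnsq x) 0.
    by rewrite x0 mulr0 (hnsq_eq0 x0) inner0r Normc.normc0 expr0n.
  have x_gt0 : 0 < hnsq x by rewrite lt0r x0 hnsq_ge0.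
  pose a : C := inner (y - z) x * (hnsq x)^-1%:C.
  have /deltaP : D (a *: x + z) by exact: DL.
  have -> : y - (a *: x + z) = (y - z) - a *: x.
    by rewrite opprD [in LHS]addrA addrAC.
  rewrite hnsqD hnsqN innerNr innerZr.
  have -> : hnsq (a *: x) = Normc.normc (inner (y - z) x) ^+ 2 / hnsq x.
    rewrite hnsqZ Normc.normcM exprMn /= expr0n addr0 sqrtr_sqr.
    by rewrite ger0_norm ?invr_ge0 ?ltW// expr2; field.
  have -> : a^* * inner (y - z) x =
            (Normc.normc (inner (y - z) x) ^+ 2 / hnsq x)%:C.
    rewrite nsqE /a; case: (inner (y - z) x) => u v; apply/eqP.
    by rewrite eq_complex /=; apply/andP; split; apply/eqP; ring.
  rewrite -ler_pdivrMr//=; set A := _ / hnsq x => ?; lra.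
apply: normc_sq_eq0; apply/eqP; rewrite eq_le sqr_ge0 andbT.
apply: le0_small => e e0.
have [x0|x0] := eqVneq (hnsq x) 0.
  by rewrite (hnsq_eq0 x0) inner0r Normc.normc0 expr0n ltW.
have x_gt0 : 0 < hnsq x by rewrite lt0r x0 hnsq_ge0.
(* The 4 pays for the factor 2 of [normc_sqD_le] and for two error terms: the excess of [d n] over
   [delta], and the squared distance of [d n] to [p]. *)
have e'0 : 0 < e / (4 * hnsq x) by rewrite divr_gt0// mulr_gt0.
have [[N Ne] [M Me]] := (harmonic_lt e'0, pP _ e'0).
pose n := maxn N M.
have {Ne Me}[ne me] := (Ne n (leq_maxl _ _), Me n (leq_maxr _ _)).
rewrite -(subrKA (d n)) innerDl; apply: (le_trans (normc_sqD_le _ _)).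
have [Dn dn] := dP n.
apply: (@le_trans _ _ (2 * (n.+1%:R^-1 * hnsq x + hnsq (d n - p) * hnsq x))).
  rewrite ler_pM2l// lerD ?hilbert_cauchy_schwarz//.
  by apply: (le_trans (ort _ Dn)); rewrite ler_pM2r// lerBlDl ltW.
rewrite -mulrDl mulrA -ler_pdivlMr//.
have -> : e / hnsq x = 4 * (e / (4 * hnsq x)) by field.
by move: ne me; set a := n.+1%:R^-1; set b := e / _ => ? ?; lra.
Qed.

(** If [U l] is the projection of [y] on the range, then <U x, y> = <U x, U l> = <x, l>, so [l]
    serves as the value of the adjoint at [y]. *)
Lemma isometry_adjoint H (U : {linear H -> H}) :
  (forall x, hnsq (U x) = hnsq x) ->
  exists2 V : H -> H, (forall x y, inner (U x) y = inner x (V y)) & cancel U V.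
Proof.
move=> Uiso.
(* Polarization: norms of sums give the real parts, and replacing [x] by -i x turns imaginary parts
   into real ones. *)
have Uin x y : inner (U x) (U y) = inner x y.
  have ReU z t : complex.Re (inner (U z) (U t)) = complex.Re (inner z t).
    have := Uiso (z + t); rewrite linearD !hnsqD !Uiso => /addrI.
    by move=> /mulfI; apply; rewrite pnatr_eq0.
  apply/eqP; rewrite eq_complex ReU eqxx /=; apply/eqP.
  have := ReU (- 'i *: x) y; rewrite linearZ !innerZl.
  move: (inner (U x) (U y)) (inner x y) => [a b] [c d] /=.
  by rewrite !mulNr !mul0r !mul1r !oppr0 !add0r !opprK.
suff /choice[V VP] y : exists z, forall x, inner (U x) y = inner x z.
  exists V => [x y|x]; first exact: VP.
  by apply: inner_ext => z; rewrite -VP Uin.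
have [||p [pU py]] := @hilbert_projection H (range U) y.
- by exists 0; rewrite // linear0.
- by move=> a _ _ [x _ <-] [z _ <-]; exists (a *: x + z); rewrite // linearP.
have /choice[z zP] n : exists z, hnsq (U z - p) < n.+1%:R^-1.
  have [|_ [z _ <-] zn] := pU n.+1%:R^-1; first by rewrite invr_gt0.
  by exists z.
have [l lP] : exists l, forall e : R, 0 < e -> exists N, forall n, (N <= n)%N ->
    hnsq (z n - l) < e.
  apply: hilbert_complete => e e0; have [N Ne] := @harmonic_lt (e / 4) ltac:(lra).
  exists N => n m /Ne ne /Ne me; rewrite -Uiso linearB.
  apply: (le_lt_trans (hnsqB_le _ p _)); rewrite (hnsqBC p).
  by have := lt_trans (zP n) ne; have := lt_trans (zP m) me => *; lra.
(* The range is closed: preimages of a sequence tending to [p] are Cauchy because [U] preserves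
   distances. *)
have pE : p = U l.
  apply/eqP; rewrite -subr_eq0; apply/eqP/hnsq_eq0/eqP.
  rewrite eq_le hnsq_ge0 andbT; apply: le0_small => e e0.
  have e4 : 0 < e / 4 by lra.
  have [[N Ne] [M Me]] := (harmonic_lt e4, lP _ e4).
  have := Ne _ (leq_maxl N M); have := Me _ (leq_maxr N M).
  set n := maxn N M => ? ne; apply: (le_trans (hnsqB_le _ (U (z n)) _)).
  by rewrite hnsqBC -linearB Uiso; have := lt_trans (zP n) ne => ?; lra.
exists l => x; rewrite -[RHS]Uin -pE; apply/eqP; rewrite -subr_eq0 -innerBr innerC.
by rewrite py ?conjc0.
Qed.

(** A vector orthogonal to the range of a symmetric [B] lies in its kernel, which is trivial. *)
Lemma dense_range_symmetric H (B : {linear H -> H}) :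
  (forall x y, inner (B x) y = inner x (B y)) -> injective B -> dense (range B).
Proof.
move=> Bsym Binj; apply: dense_hnsq => y e e0.
have [||p [pB py]] := @hilbert_projection H (range B) y.
- by exists 0; rewrite // linear0.
- by move=> a _ _ [x _ <-] [z _ <-]; exists (a *: x + z); rewrite // linearP.
suff -> : y = p by exact: pB.
apply/eqP; rewrite -subr_eq0; apply/eqP/Binj; rewrite linear0.
by apply: eq0_innerl => x; rewrite -Bsym innerC py ?conjc0.
Qed.

End hilbert.

Lemma expr_small (R : realType) (a e : R) : 0 <= a -> a < 1 -> 0 < e ->
  exists N, forall n, (N <= n)%N -> a ^+ n < e.
Proof.
move=> a0 a1 e0; have /cvgrPdist_lt/(_ _ e0)[N _ Ne] : a ^+ n @[n --> \oo] --> 0.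
  by apply: cvg_expr; rewrite ger0_norm.
by exists N => n /Ne; rewrite sub0r normrN ger0_norm// exprn_ge0.
Qed.

(** * Norms from inner products, and completeness tested on fast Cauchy sequences *)

Section hilbert_of_dot.
Context {R : realType} {U : lmodType R[i]}.
Variable dot : {dot U for (Num.conj : R[i] -> R[i])}.
Local Notation C := R[i].

Definition dot_norm (x : U) : C := sqrtC (dot x x).

Lemma dot_normZ (a : C) (x : U) : dot_norm (a *: x) = `|a| * dot_norm x.
Proof.
rewrite /dot_norm dnormZ sqrtCM ?nnegrE ?dnorm_ge0 ?exprn_ge0//.
by rewrite sqrCK.
Qed.

Lemma dot_norm_eq0 (x : U) : dot_norm x = 0 -> x = 0.
Proof. by move=> /eqP; rewrite sqrt_dnorm_eq0 => /eqP. Qed.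

End hilbert_of_dot.

Section completeness.
Context {R : realType} {N : normedModType R[i]}.
Local Notation C := R[i].
Local Open Scope complex_scope.
Variable Q : N -> R.
Hypothesis QE : forall x : N, `|x| ^+ 2 = (Q x)%:C.

Lemma normr_ltQ (x : N) (e : R) : 0 < e -> (`|x| < e%:C) = (Q x < e ^+ 2).
Proof.
move=> e0; rewrite -ltr_sqr ?nnegrE// ?ler0c ?(ltW e0)//.
by rewrite QE -rmorphXn ltcR.
Qed.

(* The rate 16^-n leaves room for the weights 4^n of [riesz_fischer]. *)
Lemma complete_of_sequences :
  (forall u : nat -> N,
     (forall n m, (n <= m)%N -> Q (u n - u m) < 16^-1 ^+ n) ->
     exists l, forall e : R, 0 < e -> exists M, forall n, (M <= n)%N ->
       Q (u n - l) < e) ->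
  forall F : set_system N, ProperFilter F -> cauchy F -> cvg F.
Proof.
move=> QC F FF /cauchyP Fc.
(* Balls belonging to a proper filter meet, so for n <= m the centres are less than 2 r_n < 4^-n
   apart, and 16^-n is the square of that. *)
pose r n : R := 4^-1 ^+ n.+1.
have r0 n : 0 < r n by rewrite exprn_gt0.
have /choice[u uP] n : exists x, F (ball x (r n)%:C).
  by have [|x Fx] := Fc (r n)%:C; [rewrite lt0cR|exists x].
have [n m nm|l lP] := QC u.
  have [x [xn xm]] := filter_ex (filterI (uP n) (uP m)).
  have -> : 16^-1 ^+ n = (4^-1 ^+ n) ^+ 2 :> R.
    by rewrite -exprM mulnC exprM; congr (_ ^+ n); field.
  rewrite -normr_ltQ ?exprn_gt0// -(subrKA x).
  apply: (le_lt_trans (ler_normD _ _)).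
  have /le_lt_trans -> // : `|u n - x| + `|x - u m| <= (r n)%:C + `|x - u m|.
    by rewrite lerD2r ltW//; move: xn; rewrite -ball_normE.
  apply: (@lt_le_trans _ _ ((r n)%:C + (r m)%:C)).
    by rewrite ltrD2l distrC; move: xm; rewrite -ball_normE.
  rewrite -rmorphD lecR; apply: (@le_trans _ _ (r n + r n)).
    by rewrite lerD2l /r ler_wiXn2l// ?invr_ge0 ?invf_le1 ?ler1n.
  have : 0 < 4^-1 ^+ n :> R by rewrite exprn_gt0.
  by rewrite /r exprS; set a := _ ^+ n => ?; lra.
apply/cvg_ex; exists l; apply/cvgrPdist_lt => e.
case: e => e i; rewrite ltcE /= => /andP[/eqP -> e0].
have [M lM] := lP ((e / 2) ^+ 2) ltac:(by rewrite exprn_gt0// divr_gt0).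
have [K rK] := @expr_small R 4^-1 (e / 2) ltac:(lra) ltac:(lra) ltac:(lra).
pose n := maxn M K.
apply: filterS (uP n) => x; rewrite -ball_normE /= => ux.
rewrite -(subrKA (u n)) (le_lt_trans (ler_normD _ _))//.
have -> : e +i* 0 = (e / 2)%:C + (e / 2)%:C.
  by rewrite -rmorphD -splitr.
apply: ltrD.
  by rewrite distrC normr_ltQ ?divr_gt0// lM// leq_maxl.
by apply: (lt_trans ux); rewrite ltcR rK// leqW// leq_maxr.
Qed.

End completeness.

(** A separate name for the pairs, since the product type already carries the maximum norm. *)
Definition hsum {R : realType} (H : hilbertType R) : Type := (H * H)%type.

Section hsum.
Context {R : realType} (H : hilbertType R).
Local Notation C := R[i].
Local Notation HH := (hsum H).

HB.instance Definition _ := GRing.Lmodule.copy HH (H * H)%type.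
HB.instance Definition _ := Choice.copy HH (H * H)%type.

Definition hsum_dot (p q : HH) : C := inner p.1 q.1 + inner p.2 q.2.

Lemma hsum_dot_linearl (q : HH) : linear_for *%R (hsum_dot ^~ q).
Proof.
by move=> a p r; rewrite /hsum_dot /= !innerDl !innerZl mulrDr addrACA.
Qed.

Lemma hsum_dot_linearr (p : HH) : linear_for (Num.conj \; *%R) (hsum_dot p).
Proof.
by move=> a q r; rewrite /hsum_dot /= !innerDr !innerZr mulrDr addrACA.
Qed.

HB.instance Definition _ := bilinear_isBilinear.Build C HH HH C
  *%R (Num.conj \; *%R) hsum_dot (hsum_dot_linearl, hsum_dot_linearr).

Lemma hsum_dot_hermitian (p q : HH) :
  hsum_dot p q = (-1) ^+ false * Num.conj (hsum_dot q p).
Proof. by rewrite mul1r /hsum_dot rmorphD; congr (_ + _); exact: innerC. Qed.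

HB.instance Definition _ :=
  isHermitianSesquilinear.Build C HH false Num.conj hsum_dot hsum_dot_hermitian.

Lemma hsum_dotE (p : HH) : hsum_dot p p = (hnsq p.1 + hnsq p.2)%:C%C.
Proof. by rewrite /hsum_dot !inner_hnsq rmorphD. Qed.

Lemma hsum_dot_gt0 (p : HH) : p != 0 -> 0 < hsum_dot p p.
Proof.
move=> p0; rewrite hsum_dotE lt0cR lt_neqAle addr_ge0 ?hnsq_ge0// andbT eq_sym.
apply: contra p0; rewrite paddr_eq0 ?hnsq_ge0// => /andP[/eqP p1 /eqP p2].
by case: p p1 p2 => x y /= /hnsq_eq0-> /hnsq_eq0->.
Qed.

HB.instance Definition _ := isDotProduct.Build C HH hsum_dot hsum_dot_gt0.

Definition hsum_inner : {dot HH for Num.conj} := hsum_dot.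

HB.instance Definition _ := Lmodule_isNormed.Build C HH
  (dot_triangle hsum_inner) (dot_normZ hsum_inner) (@dot_norm_eq0 _ _ hsum_inner).

Lemma hsum_normE (p : HH) : `|p| ^+ 2 = (hnsq p.1 + hnsq p.2)%:C%C.
Proof. by rewrite -hsum_dotE -[LHS]/(dot_norm hsum_inner p ^+ 2) sqrtCK. Qed.

Lemma hsum_complete (F : set_system HH) : ProperFilter F -> cauchy F -> cvg F.
Proof.
apply: (complete_of_sequences hsum_normE) => u uC.
have uC' (e : R) : 0 < e -> exists M, forall n m, (M <= n)%N -> (M <= m)%N ->
    hnsq (u n - u m).1 + hnsq (u n - u m).2 < e.
  move=> e0; have [M Me] := @expr_small R 16^-1 e ltac:(lra) ltac:(lra) e0.
  exists M => n m Mn Mm.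
  have [nm|/ltnW mn] := leqP n m; first by rewrite (lt_trans (uC _ _ nm)) ?Me.
  rewrite /= hnsqBC [hnsq (_ - _).2]hnsqBC.
  exact: lt_trans (uC _ _ mn) (Me _ Mm).
have [l1 l1P] : exists l, forall e : R, 0 < e -> exists M, forall n, (M <= n)%N ->
    hnsq ((u n).1 - l) < e.
  apply: hilbert_complete => e /uC'[M Me]; exists M => n m Mn Mm.
  by apply: le_lt_trans (Me n m Mn Mm); rewrite lerDl hnsq_ge0.
have [l2 l2P] : exists l, forall e : R, 0 < e -> exists M, forall n, (M <= n)%N ->
    hnsq ((u n).2 - l) < e.
  apply: hilbert_complete => e /uC'[M Me]; exists M => n m Mn Mm.
  by apply: le_lt_trans (Me n m Mn Mm); rewrite lerDr hnsq_ge0.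
exists (l1, l2) => e e0.
have [[M1 M1P] [M2 M2P]] := (l1P (e / 2) ltac:(lra), l2P (e / 2) ltac:(lra)).
exists (maxn M1 M2) => n; rewrite geq_max => /andP[/M1P ? /M2P ?].
by rewrite [ltRHS]splitr ltrD.
Qed.

HB.instance Definition _ := Uniform_isComplete.Build HH hsum_complete.

HB.instance Definition _ := CompleteNormedModule_isHilbert.Build R HH
  (fun p : HH => esym (sqrtCK (hsum_inner p p))).

Lemma hnsq_hsum (p : HH) : hnsq p = hnsq p.1 + hnsq p.2.
Proof. by rewrite {1}/hnsq -[inner p p]/(hsum_dot p p) hsum_dotE. Qed.

End hsum.

(** * Normal extensions of quasinormal operators *)

Lemma closed_inner_eq0 (R : realType) (K : hilbertType R) (a b : K) :
  closed [set p : K * K | inner p.1 a + inner p.2 b = 0].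
Proof.
move=> p pA; apply: normc_sq_eq0; apply/eqP; rewrite eq_le sqr_ge0 andbT.
apply: le0_small => e e0.
(* With radius r and r^2 = e / c, Cauchy-Schwarz bounds the squared modulus by 2 r^2 (|a|^2 + |b|^2)
   <= e; the summand 1 keeps [c] positive. *)
pose c := 2 * (hnsq a + hnsq b) + 1.
have c0 : 0 < c by rewrite ltr_wpDl// mulr_ge0// addr_ge0 ?hnsq_ge0.
pose r := Num.sqrt (e / c); have r0 : 0 < r by rewrite sqrtr_gt0 divr_gt0.
have [|q [/= qE [pq1 pq2]]] := pA (ball p r%:C%C).
  by apply: nbhsx_ballx; rewrite lt0cR.
have r2 : r ^+ 2 = e / c by rewrite sqr_sqrtr// ltW// divr_gt0.
move: pq1 pq2; rewrite -!ball_normE /= !normr_lt_hnsq// r2 => pq1 pq2.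
have -> : inner p.1 a + inner p.2 b = inner (p.1 - q.1) a + inner (p.2 - q.2) b.
  by rewrite !innerBl addrACA -opprD qE subr0.
apply: (le_trans (normc_sqD_le _ _)).
apply: (@le_trans _ _ (2 * (e / c * hnsq a + e / c * hnsq b))).
  rewrite ler_pM2l// lerD//; apply: (le_trans (hilbert_cauchy_schwarz _ _));
  by rewrite ler_wpM2r ?hnsq_ge0// ltW.
by rewrite -mulrDr mulrCA mulrAC ler_pdivrMr// ler_pM2l// /c lerDl.
Qed.

Section unitary_times_selfadjoint.
Context {R : realType} {K : hilbertType R}.
Variables (B W : {linear K -> K}) (W' : K -> K).
Hypotheses (Bsym : forall x y, inner (B x) y = inner x (B y))
  (Binj : injective B) (Wadj : forall x y, inner (W x) y = inner x (W' y))
  (WK : cancel W W') (W'K : cancel W' W) (WB : forall x, W (B x) = B (W x)).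

Lemma W'D (x y : K) : W' (x + y) = W' x + W' y.
Proof. by apply: inner_ext => z; rewrite innerDr -!Wadj innerDr. Qed.

Lemma W'B (x : K) : W' (B x) = B (W' x).
Proof. by rewrite -{1}[x]W'K -WB WK. Qed.

(* The graph of W M, where M = B^-1 - 1 is self-adjoint. *)
Definition wm_graph : set (K * K) :=
  [set p | exists z, p = (B z, W (z - B z))].

Lemma wm_graph0 : wm_graph 0.
Proof. by exists 0; rewrite linear0 subr0 linear0. Qed.

Lemma wm_graph_linear (a : R[i]) p q :
  wm_graph p -> wm_graph q -> wm_graph (a *: p + q).
Proof.
move=> [z ->] [t ->]; exists (a *: z + t); congr pair; first by rewrite linearP.
rewrite -[LHS]/(a *: W (z - B z) + W (t - B t)) -linearP; congr (W _).
by rewrite linearP opprD addrACA -scalerBr.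
Qed.

Lemma wm_graph_functional x y z :
  wm_graph (x, y) -> wm_graph (x, z) -> y = z.
Proof. by move=> [s [-> ->]] [t [/Binj -> ->]]. Qed.

Definition wm_operator : operator K :=
  Operator wm_graph0 wm_graph_linear wm_graph_functional.

(** The parameter is recovered as [z = x + W' y], so membership becomes an equation between
    everywhere defined maps and no unbounded operator is left. *)
Lemma wm_graphP x y : wm_graph (x, y) <-> x = B (x + W' y).
Proof.
split=> [[z [-> ->]]|xy]; first by rewrite WK subrKC.
exists (x + W' y); rewrite -xy; congr pair.
by rewrite addrAC subrr add0r W'K.
Qed.

(** The adjoint of W M is M W', that is W' M by commutation; its graph has the form of [wm_graphP]
    with [W] and [W'] exchanged. *)
Lemma adjoint_wm_graphP x y : adjoint wm_graph (x, y) <-> x = B (x + W y).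
Proof.
(* The right-hand form is the one produced by testing against all parameters [z] and moving [W] and
   [B] to the other side. *)
have -> : x = B (x + W y) <-> W' x = B (W' x + y).
  split=> [xy|xy]; first by rewrite {1}xy W'B W'D WK.
  by rewrite -{1}[x]W'K xy WB linearD W'K.
split=> [xy|xy].
  apply: inner_ext => z.
  have := xy _ _ (ex_intro _ z erefl); rewrite /= Wadj innerBl !Bsym => /eqP.
  by rewrite subr_eq addrC -innerDr => /eqP ->; rewrite -linearD addrC.
move=> _ _ [z [-> ->]] /=; rewrite Wadj innerBl {1}xy !Bsym -innerBr -linearB.
by rewrite [W' x + y]addrC addrK.
Qed.

Lemma normal_wm_operator : normal_operator wm_operator.
Proof.
split.
- have -> : dom wm_operator = range B.
    apply/seteqP; split => [_ [_ [z [-> _]]]|_ [z _ <-]]; first by exists z.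
    by exists (W (z - B z)), z.
  exact: dense_range_symmetric.
(* Testing the equation of [wm_graphP] against [t] gives one closed linear condition on the pair,
   and the graph is the intersection of these conditions. *)
- have orthP x y t : inner x (B t - t) + inner y (W (B t)) =
      inner (B (x + W' y) - x) t.
    rewrite innerBl Bsym innerDl innerBr addrAC; congr (_ + _ - _).
    by rewrite innerC Wadj -innerC.
  have -> : graph wm_operator = \bigcap_t
      [set p : K * K | inner p.1 (B t - t) + inner p.2 (W (B t)) = 0].
    apply/seteqP; split => [[x y] /wm_graphP xy t _ /=|[x y] xy].
      by rewrite orthP -xy subrr inner0l.
    apply/wm_graphP/eqP; rewrite eq_sym -subr_eq0; apply/eqP/eq0_innerl => t.
    by rewrite innerC -orthP xy// conjc0.
  by apply: closed_bigI => t _; exact: closed_inner_eq0.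
(* Here x = B (x + s) says s = M x and s = B (s + t) says t = M s. Both products of the operator and
   its adjoint are thus M^2, the unitary factors cancelling. *)
have N'N x t : op_comp (adjoint wm_graph) wm_graph (x, t) <->
    exists2 s, x = B (x + s) & s = B (s + t).
  split=> [[y /wm_graphP xy /adjoint_wm_graphP yt]|[s xs st]].
    by exists (W' y) => //; rewrite {1}yt W'B W'D WK.
  exists (W s); first by apply/wm_graphP; rewrite WK.
  by apply/adjoint_wm_graphP; rewrite -linearD -WB -st.
have NN' x t : op_comp wm_graph (adjoint wm_graph) (x, t) <->
    exists2 s, x = B (x + s) & s = B (s + t).
  split=> [[y /adjoint_wm_graphP xy /wm_graphP yt]|[s xs st]].
    by exists (W y) => //; rewrite {1}yt WB linearD W'K.
  exists (W' s); first by apply/adjoint_wm_graphP; rewrite W'K.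
  by apply/wm_graphP; rewrite -W'D -W'B -st.
by apply/seteqP; split => -[x t]; [move/N'N/NN'|move/NN'/N'N].
Qed.

End unitary_times_selfadjoint.

(* The quasinormal operator U M, with U an isometry commuting with the
   self-adjoint operator M = B^-1 - 1, extends to W (M (+) M), where
   W (x, y) = (U x + (1 - U U* ) y, U* y) is a unitary dilation of U. *)
Lemma quasinormal_normal_extension (R : realType) (H : hilbertType R)
    (B U : {linear H -> H}) :
  (forall x y, inner (B x) y = inner x (B y)) -> injective B ->
  (forall x, hnsq (U x) = hnsq x) -> (forall x, U (B x) = B (U x)) ->
  exists N : operator (hsum H), normal_operator N /\
    forall x, graph N ((B x, 0), (U (x - B x), 0)).
Proof.
move=> Bsym Binj Uiso UB; have [V UV UK] := isometry_adjoint Uiso.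
have VP a x y : V (a *: x + y) = a *: V x + V y.
  by apply: inner_ext => z; rewrite -UV !innerDr !innerZr !UV.
have VD x y : V (x + y) = V x + V y by rewrite -[x]scale1r VP !scale1r.
have V0 : V 0 = 0 by rewrite -{1}(linear0 U) UK.
have VN x : V (- x) = - V x.
  by rewrite -[- x]addr0 -scaleN1r VP V0 addr0 scaleN1r.
have VU x y : inner (V x) y = inner x (U y).
  by rewrite innerC -UV -innerC.
have UVs x y : inner (U (V x)) y = inner x (U (V y)) by rewrite UV VU.
(* This is the adjoint of the relation [UB], as [B] is symmetric. *)
have VB x : V (B x) = B (V x).
  by apply: inner_ext => z; rewrite -UV -Bsym -UB UV Bsym.
pose f (p : hsum H) : hsum H := (B p.1, B p.2).
pose g (p : hsum H) : hsum H := (U p.1 + (p.2 - U (V p.2)), V p.2).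
(* The transposed block matrix with adjoint entries. It is also the inverse of [g]: by [UK], U V is
   the projection on the range of [U], so 1 - U V is annihilated by [V] from the left and by [U]
   from the right. *)
pose g' (p : hsum H) : hsum H := (V p.1, p.1 - U (V p.1) + U p.2).
have fL : linear f by move=> a [x y] [z t]; rewrite /f /= !linearP.
have gL : linear g.
  move=> a [x y] [z t]; rewrite /g /= VP !(linearP U); congr pair => /=.
  by rewrite opprD [a *: y + t + _]addrACA -scalerBr (scalerDr a (U x)) [RHS]addrACA.
pose B2 : {linear hsum H -> hsum H} :=
  HB.pack f (GRing.isLinear.Build _ _ _ _ f fL).
pose W : {linear hsum H -> hsum H} :=
  HB.pack g (GRing.isLinear.Build _ _ _ _ g gL).
have B2sym p q : inner (B2 p) q = inner p (B2 q).
  by rewrite -[LHS]/(hsum_dot (B2 p) q) -[RHS]/(hsum_dot p (B2 q)) /hsum_dot !Bsym.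
have B2inj : injective B2 by move=> [x y] [z t] [/Binj -> /Binj ->].
have Wadj p q : inner (W p) q = inner p (g' q).
  rewrite -[LHS]/(hsum_dot (g p) q) -[RHS]/(hsum_dot p (g' q)) /hsum_dot /=.
  by rewrite !(innerDl, innerDr, innerNl, innerNr) UVs VU (UV p.1) !addrA.
have WK : cancel W g'.
  move=> [x y]; rewrite /W /g /g' /=; congr pair.
    by rewrite !VD VN !UK subrr addr0.
  by rewrite !VD VN !UK subrr addr0 [U x + _]addrC addrK subrK.
have W'K : cancel g' W.
  move=> [x y]; rewrite /W /g /g' /=; congr pair.
    by rewrite !VD VN !UK subrr add0r [U (V x) + _]addrC addrK subrK.
  by rewrite !VD VN !UK subrr add0r.
have WB p : W (B2 p) = B2 (W p).
  by rewrite /W /B2 /f /g /= !UB !VB !UB !linearD linearN.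
exists (wm_operator W B2inj); split; first exact: (normal_wm_operator B2sym B2inj Wadj).
move=> x; exists (x, 0); congr pair; first by rewrite -[RHS]/(B x, B 0) linear0.
rewrite -[RHS]/(U (x - B x) + ((0 - B 0) - U (V (0 - B 0))), V (0 - B 0)).
by rewrite linear0 subr0 V0 linear0 subr0 addr0.
Qed.

(** * The complex space L^2 *)

Section square_integrable.
Context d (T : measurableType d) (R : realType).
Variable mu : {measure set T -> \bar R}.
Local Notation C := R[i].
Local Notation Re := (@complex.Re R).
Local Notation Im := (@complex.Im R).
Local Notation conj := (@Num.conj C).
Local Open Scope complex_scope.
Implicit Types f g h : T -> C.

Definition cmeasurable f :=
  measurable_fun setT (fun x => Re (f x)) /\ measurable_fun setT (fun x => Im (f x)).

Definition csqnorm f : \bar R := (\int[mu]_x (Normc.normc (f x) ^+ 2)%:E)%E.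

Definition sqint f := cmeasurable f /\ (csqnorm f < +oo)%E.

Lemma cmeasurableP (a : C) f g :
  cmeasurable f -> cmeasurable g -> cmeasurable (fun x => a * f x + g x).
Proof.
move=> [fr fi] [gr gi]; split.
  rewrite (_ : (fun _ => _) = (fun x => Re a * Re (f x) - Im a * Im (f x) + Re (g x))).
    by apply: measurable_funD => //; apply: measurable_funB; exact: measurable_funM.
  by apply/funext => x; case: a (f x) (g x) => [? ?] [? ?] [? ?].
rewrite (_ : (fun _ => _) = (fun x => Re a * Im (f x) + Im a * Re (f x) + Im (g x))).
  by apply: measurable_funD => //; apply: measurable_funD; exact: measurable_funM.
by apply/funext => x; case: a (f x) (g x) => [? ?] [? ?] [? ?].
Qed.

Lemma cmeasurableM f g :
  cmeasurable f -> cmeasurable g -> cmeasurable (fun x => f x * g x).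
Proof.
move=> [fr fi] [gr gi]; split.
  rewrite (_ : (fun _ => _) = (fun x => Re (f x) * Re (g x) - Im (f x) * Im (g x))).
    by apply: measurable_funB; exact: measurable_funM.
  by apply/funext => x; case: (f x) (g x) => [? ?] [? ?].
rewrite (_ : (fun _ => _) = (fun x => Re (f x) * Im (g x) + Im (f x) * Re (g x))).
  by apply: measurable_funD; exact: measurable_funM.
by apply/funext => x; case: (f x) (g x) => [? ?] [? ?].
Qed.

Lemma cmeasurable_conj f : cmeasurable f -> cmeasurable (fun x => conj (f x)).
Proof.
move=> [fr fi]; split.
  by rewrite (_ : (fun _ => _) = (fun x => Re (f x)))//; apply/funext => x; case: (f x).
rewrite (_ : (fun _ => _) = (fun x => - Im (f x))); first exact: measurable_funN.
by apply/funext => x; case: (f x).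
Qed.

Lemma cmeasurable_nsq f : cmeasurable f ->
  measurable_fun setT (fun x => (Normc.normc (f x) ^+ 2)%:E).
Proof.
move=> [fr fi]; apply/measurable_EFinP; under eq_fun do rewrite nsqE.
by apply: measurable_funD; apply: measurable_funX.
Qed.

Lemma csqnorm_ge0 f : (0 <= csqnorm f)%E.
Proof. by apply: integral_ge0 => x _; rewrite lee_fin sqr_ge0. Qed.

Lemma csqnormD_le f g : cmeasurable f -> cmeasurable g ->
  (csqnorm (fun x => f x + g x)%R <= 2%:E * (csqnorm f + csqnorm g))%E.
Proof.
move=> mf mg.
have mfg : cmeasurable (fun x => f x + g x).
  rewrite (_ : (fun _ => _) = (fun x => 1 * f x + g x)); first exact: cmeasurableP.
  by apply/funext => x; rewrite mul1r.
rewrite /csqnorm -ge0_integralD//;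
  do ?[exact: cmeasurable_nsq|by move=> *; rewrite lee_fin sqr_ge0].
rewrite -ge0_integralZl_EFin//; last 2 first.
- by move=> *; rewrite -EFinD lee_fin addr_ge0 ?sqr_ge0.
- by apply: emeasurable_funD; exact: cmeasurable_nsq.
apply: ge0_le_integral => //; do ?[exact: cmeasurable_nsq].
- by move=> *; rewrite lee_fin sqr_ge0.
- by apply: measurable_funeM; apply: emeasurable_funD; exact: cmeasurable_nsq.
- by move=> x _; rewrite -EFinD -EFinM lee_fin normc_sqD_le.
Qed.

Lemma csqnormZ (a : C) f : cmeasurable f ->
  csqnorm (fun x => a * f x) = ((Normc.normc a ^+ 2)%:E * csqnorm f)%E.
Proof.
move=> mf; rewrite /csqnorm; under eq_integral do rewrite Normc.normcM exprMn EFinM.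
rewrite ge0_integralZl_EFin ?sqr_ge0//; first by move=> *; rewrite lee_fin sqr_ge0.
exact: cmeasurable_nsq.
Qed.

Lemma sqintP (a : C) f g : sqint f -> sqint g -> sqint (fun x => a * f x + g x).
Proof.
move=> [mf f2] [mg g2]; split; first exact: cmeasurableP.
have maf : cmeasurable (fun x => a * f x).
  rewrite (_ : (fun x => _) = (fun x => a * f x + (fun=> 0) x)).
    by apply: cmeasurableP => //; split; exact: measurable_cst.
  by apply/funext => x; rewrite addr0.
apply: (le_lt_trans (csqnormD_le maf mg)).
by rewrite csqnormZ// lte_mul_pinfty// lte_add_pinfty// lte_mul_pinfty ?lee_fin ?sqr_ge0.
Qed.

Lemma sqint0 : sqint (fun=> 0).
Proof.
split; first by split; exact: measurable_cst.
by rewrite /csqnorm; under eq_integral do rewrite Normc.normc0 expr0n; rewrite integral0.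
Qed.

Lemma sqintB f g : sqint f -> sqint g -> sqint (fun x => f x - g x).
Proof.
move=> hf hg; rewrite (_ : (fun _ => _) = (fun x => -1 * g x + f x)).
  exact: sqintP.
by apply/funext => x; rewrite mulN1r addrC.
Qed.

Definition cintegrable h :=
  mu.-integrable setT (fun x => (Re (h x))%:E) /\
  mu.-integrable setT (fun x => (Im (h x))%:E).

Definition cintegral h : C :=
  (\int[mu]_x Re (h x))%R +i* (\int[mu]_x Im (h x))%R.

Lemma cintegrableM f g :
  sqint f -> sqint g -> cintegrable (fun x => f x * conj (g x)).
Proof.
move=> [mf f2] [mg g2].
have [mr mi] := cmeasurableM mf (cmeasurable_conj mg).
have h : mu.-integrable setT
    (fun x => (Normc.normc (f x) ^+ 2)%:E + (Normc.normc (g x) ^+ 2)%:E)%E.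
  apply: integrableD => //; apply/integrableP; split; do ?exact: cmeasurable_nsq.
  - by under eq_integral do rewrite gee0_abs ?lee_fin ?sqr_ge0//.
  - by under eq_integral do rewrite gee0_abs ?lee_fin ?sqr_ge0//.
split; apply: le_integrable h => //; do ?exact/measurable_EFinP; move=> x _.
  rewrite -EFinD lee_fin [leRHS]ger0_norm ?addr_ge0 ?sqr_ge0// !nsqE.
  case: (f x) (g x) => [a b] [a' b'] /=.
  have := sqr_ge0 (a - a'); have := sqr_ge0 (b - b').
  have := sqr_ge0 (a + a'); have := sqr_ge0 (b + b').
  by rewrite !expr2 ler_norml => *; apply/andP; split; lra.
rewrite -EFinD lee_fin [leRHS]ger0_norm ?addr_ge0 ?sqr_ge0// !nsqE.
case: (f x) (g x) => [a b] [a' b'] /=.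
have := sqr_ge0 (a - b'); have := sqr_ge0 (b - a').
have := sqr_ge0 (a + b'); have := sqr_ge0 (b + a').
by rewrite !expr2 ler_norml => *; apply/andP; split; lra.
Qed.

Lemma cintegralP (a : C) f g : cintegrable f -> cintegrable g ->
  cintegral (fun x => a * f x + g x) = a * cintegral f + cintegral g.
Proof.
move=> [fr fi] [gr gi]; rewrite /cintegral.
have reE x : Re (a * f x + g x) = Re a * Re (f x) - Im a * Im (f x) + Re (g x).
  by case: a (f x) (g x) => [? ?] [? ?] [? ?].
have imE x : Im (a * f x + g x) = Re a * Im (f x) + Im a * Re (f x) + Im (g x).
  by case: a (f x) (g x) {reE} => [? ?] [? ?] [? ?].
under eq_Rintegral do rewrite reE.
under [X in _ +i* X]eq_Rintegral do rewrite imE.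
have iZ (c : R) (k : T -> R) : mu.-integrable setT (fun x => (k x)%:E) ->
    mu.-integrable setT (fun x => (c * k x)%:E).
  by move=> /(integrableZl measurableT c).
have iD (k l : T -> R) : mu.-integrable setT (fun x => (k x)%:E) ->
    mu.-integrable setT (fun x => (l x)%:E) ->
    mu.-integrable setT (fun x => (k x + l x)%:E).
  by move=> ik il; have := integrableD measurableT ik il.
have iB (k l : T -> R) : mu.-integrable setT (fun x => (k x)%:E) ->
    mu.-integrable setT (fun x => (l x)%:E) ->
    mu.-integrable setT (fun x => (k x - l x)%:E).
  by move=> ik il; have := integrableB measurableT ik il.
rewrite RintegralD ?RintegralB ?RintegralZl//; do ?[exact: iZ|by apply: iB; exact: iZ].
rewrite RintegralD ?RintegralD ?RintegralZl//; do ?[exact: iZ|by apply: iD; exact: iZ].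
case: a {reE imE} => a b; apply/eqP; rewrite eq_complex /=.
by apply/andP; split; apply/eqP; ring.
Qed.

Lemma cintegral_conj h : cintegrable h ->
  cintegral (fun x => conj (h x)) = conj (cintegral h).
Proof.
move=> [hr hi]; rewrite /cintegral /=; congr (_ +i* _).
  by apply: eq_Rintegral => x _; case: (h x).
rewrite -mulN1r -RintegralZl//; apply: eq_Rintegral => x _.
by rewrite mulN1r; case: (h x).
Qed.

Lemma cintegral_nsq f : sqint f ->
  cintegral (fun x => f x * conj (f x)) = (fine (csqnorm f))%:C%C.
Proof.
move=> _; rewrite /cintegral /real_complex_def /=; congr (_ +i* _).
  by congr fine; apply: eq_integral => x _; rewrite mul_conjE.
rewrite /Rintegral (_ : integral _ _ _ = 0)//.
by rewrite integral0_eq// => x _; rewrite mul_conjE.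
Qed.

Lemma csqnorm_ae_eq f g : cmeasurable f -> cmeasurable g ->
  {ae mu, forall x, f x = g x} -> csqnorm f = csqnorm g.
Proof.
move=> mf mg fg; apply: ge0_ae_eq_integral => //; do ?exact: cmeasurable_nsq.
- by move=> x _; rewrite lee_fin sqr_ge0.
- by move=> x _; rewrite lee_fin sqr_ge0.
- by apply: filterS fg => x ->.
Qed.

Lemma csqnorm_eq0 f : cmeasurable f -> csqnorm f = 0 ->
  {ae mu, forall x, f x = 0}.
Proof.
move=> mf f0.
have := (@ae_eq_integral_abs _ _ _ mu _ measurableT _ (cmeasurable_nsq mf)).1.
under eq_integral do rewrite gee0_abs ?lee_fin ?sqr_ge0//.
move=> /(_ f0); apply: filterS => x /(_ I) /= [] /normc_sq_eq0.
exact.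
Qed.

Lemma cintegral_ae0 h : cmeasurable h -> {ae mu, forall x, h x = 0} -> cintegral h = 0.
Proof.
move=> [mr mi] h0; rewrite /cintegral /Rintegral.
have z (k : T -> R) : measurable_fun setT k -> {ae mu, forall x, k x = 0} ->
    (\int[mu]_x (k x)%:E)%E = 0%E.
  move=> mk k0; rewrite (@ae_eq_integral _ _ _ _ setT (cst 0)%E) ?integral0//.
    exact/measurable_EFinP.
  by apply: filterS k0 => x /= ->.
by rewrite !z//; apply: filterS h0 => x ->.
Qed.

End square_integrable.

(** * The Riesz-Fischer theorem *)

Lemma geometric_cvg (R : realType) (a : nat -> R) (c : R) : 0 <= c ->
  (forall n, `|a n.+1 - a n| <= c * 2^-1 ^+ n) -> cvg (a @ \oo).
Proof.
move=> c0 ac; have cvgS : cvgn (series (telescope a)).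
  apply: normed_cvg; apply: (series_le_cvg _ _ ac) => [n|n|] //.
    by rewrite mulr_ge0// exprn_ge0.
  by apply: is_cvg_geometric_series; rewrite ger0_norm ?invr_ge0// invf_lt1 ?ltr1n.
rewrite (_ : a = (fun n => a 0%N + series (telescope a) n)).
  by apply: is_cvgD => //; exact: is_cvg_cst.
by apply/funext => n; exact: eq_sum_telescope.
Qed.

Section riesz_fischer.
Context d (T : measurableType d) (R : realType).
Variable mu : {measure set T -> \bar R}.
Local Notation C := R[i].
Local Notation Re := (@complex.Re R).
Local Notation Im := (@complex.Im R).
Local Open Scope complex_scope.

(** Fatou's lemma, applied to |f_n - f_(n+m)|^2 as m grows, carries the Cauchy bound over to the
    pointwise limit. Convergence at every point makes that limit measurable. *)
Lemma csqnorm_cvg (f : nat -> T -> C) :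
  (forall n, sqint mu (f n)) ->
  (forall n m, (n <= m)%N ->
    (csqnorm mu (fun x => f n x - f m x)%R <= (16^-1 ^+ n)%:E)%E) ->
  (forall x, cvg (Re (f n x) @[n --> \oo])) ->
  (forall x, cvg (Im (f n x) @[n --> \oo])) ->
  exists2 g, sqint mu g &
    forall n, (csqnorm mu (fun x => f n x - g x)%R <= (16^-1 ^+ n)%:E)%E.
Proof.
move=> fsq fC cr ci.
pose g x : C := lim (Re (f n x) @[n --> \oo]) +i* lim (Im (f n x) @[n --> \oo]).
have mg : cmeasurable g.
  by split; apply: measurable_fun_cvg => [n|x _];
    [exact: (fsq n).1.1|exact: cr|exact: (fsq n).1.2|exact: ci].
have mfB n (k : T -> C) : cmeasurable k -> cmeasurable (fun x => f n x - k x).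
  move=> mk; rewrite (_ : (fun _ => _) = (fun x => -1 * k x + f n x)).
    by apply: cmeasurableP => //; exact: (fsq n).1.
  by apply/funext => x; rewrite mulN1r addrC.
have fg n : (csqnorm mu (fun x => f n x - g x)%R <= (16^-1 ^+ n)%:E)%E.
  pose u m x := (Normc.normc (f n x - f (n + m)%N x) ^+ 2)%:E.
  have mu_ m : measurable_fun setT (u m).
    by apply: cmeasurable_nsq; apply: mfB; exact: (fsq _).1.
  have ug x : limn_einf (u ^~ x) = (Normc.normc (f n x - g x) ^+ 2)%:E.
    suff : u ^~ x @ \oo --> (Normc.normc (f n x - g x) ^+ 2)%:E.
      by move=> /cvg_limn_einf_sup[].
    apply: cvg_EFin; first by apply: nearW.
    rewrite /u /comp /=; under eq_fun do rewrite nsqE !raddfB /=.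
    rewrite nsqE !raddfB /=.
    have cvR : Re (f (n + m)%N x) @[m --> \oo] --> lim (Re (f n x) @[n --> \oo]).
      by have := cr x; rewrite -(cvg_shiftn n); under eq_fun do rewrite addnC.
    have cvI : Im (f (n + m)%N x) @[m --> \oo] --> lim (Im (f n x) @[n --> \oo]).
      by have := ci x; rewrite -(cvg_shiftn n); under eq_fun do rewrite addnC.
    have cR := cvgB (cvg_cst (Re (f n x))) cvR.
    have cI := cvgB (cvg_cst (Im (f n x))) cvI.
    by apply: cvgD; [exact: (cvgM (cR _ _) (cR _ _))|exact: (cvgM (cI _ _) (cI _ _))].
  have := fatou mu measurableT mu_ (fun m x _ => _).
  under eq_integral do rewrite ug.
  move=> /(_ (fun m x => sqr_ge0 _))/le_trans; apply.
  rewrite limn_einf_lim; apply: lime_le; first exact: is_cvg_einfs.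
  apply: nearW => m; apply: le_trans (fC n (n + m)%N (leq_addr _ _)).
  by apply: ereal_inf_lbound; exists m; rewrite /=.
exists g => //.
rewrite (_ : g = (fun x => f 0%N x - (f 0%N x - g x))).
  apply: sqintB => //; split; first exact: mfB.
  by apply: le_lt_trans (fg 0%N) _; rewrite ltry.
by apply/funext => x; rewrite opprB addrC subrK.
Qed.

(** The weighted sum [G] of squared increments is integrable, hence finite almost everywhere, and
    where it is finite the increments are dominated by sqrt(G) 2^-n. *)
Lemma riesz_fischer (f : nat -> T -> C) :
  (forall n, sqint mu (f n)) ->
  (forall n m, (n <= m)%N ->
    (csqnorm mu (fun x => f n x - f m x)%R <= (16^-1 ^+ n)%:E)%E) ->
  exists2 g, sqint mu g &
    forall n, (csqnorm mu (fun x => f n x - g x)%R <= (16^-1 ^+ n)%:E)%E.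
Proof.
move=> fsq fC.
have mB n m : cmeasurable (fun x => f n x - f m x).
  by have [] := sqintB (fsq n) (fsq m).
pose h n x := ((4 ^+ n) * Normc.normc (f n x - f n.+1 x) ^+ 2)%:E.
have h0 n x : (0 <= h n x)%E by rewrite lee_fin mulr_ge0 ?sqr_ge0 ?exprn_ge0.
have mh n : measurable_fun setT (h n).
  rewrite /h; under eq_fun do rewrite EFinM.
  by apply: measurable_funeM; exact: cmeasurable_nsq.
pose G x := (\sum_(n <oo) h n x)%E.
have G0 x : (0 <= G x)%E by exact: nneseries_ge0.
have mG : measurable_fun setT G by exact: (ge0_emeasurable_sum (P := xpredT)).
have iG : (\int[mu]_x G x <= 2%:E)%E.
  rewrite integral_nneseries//.
  (* The n-th integral is at most 4^n 16^-n = 4^-n, estimated by 2^-n = 2 / 2^(n+1) to match a known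
     series. *)
  have <- : (\sum_(n <oo) (2 / (2 ^ (n + 1))%:R)%:E)%E = 2%:E :> \bar R.
    have /cvg_lim -> // := @cvg_geometric_eseries_half R 2 0.
    by rewrite expr0 divr1.
  apply: lee_nneseries => [n _ _|n _]; first exact: integral_ge0.
  rewrite /h; under eq_integral do rewrite EFinM.
  rewrite ge0_integralZl_EFin ?exprn_ge0//; last 2 first.
  - by move=> x _; rewrite lee_fin sqr_ge0.
  - exact: cmeasurable_nsq.
  apply: (@le_trans _ _ ((4 ^+ n)%:E * (16^-1 ^+ n)%:E)%E).
    by rewrite lee_pmul2l// ?lte_fin ?exprn_gt0//; exact: fC.
  rewrite -EFinM lee_fin -exprMn addn1 expnS natrM natrX.
  rewrite invfM mulrA mulfV ?mul1r ?pnatr_eq0// -exprVn.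
  by apply: lerXn2r; rewrite ?nnegrE; lra.
pose D := [set x | (G x < +oo)%E].
have mD : measurable D.
  by rewrite -[D]setTI; exact: emeasurable_fun_infty_o.
have aeD : {ae mu, forall x, D x}.
  have : mu.-integrable setT G.
    apply/integrableP; split => //; under eq_integral do rewrite gee0_abs//.
    by apply: le_lt_trans iG _; rewrite ltry.
  move=> /(integrable_ae measurableT); apply: filterS => x /(_ I).
  by rewrite ge0_fin_numE.
(* Cutting off outside [D] changes each function on a null set and makes the sequence converge
   everywhere, as [csqnorm_cvg] requires. *)
pose chi x : C := (\1_D x)%:C.
have mchi : cmeasurable chi.
  by split; [exact: measurable_indic|exact: measurable_cst].
pose f' n x := chi x * f n x.
have aef n : {ae mu, forall x, f' n x = f n x}.
  apply: filterS aeD => x Dx.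
  by rewrite /f' /chi indicE mem_set//= mul1r.
have mf' n : cmeasurable (f' n) by apply: cmeasurableM => //; exact: (fsq n).1.
have f'sq n : sqint mu (f' n).
  by split => //; rewrite (csqnorm_ae_eq (mf' n) (fsq n).1 (aef n)); exact: (fsq n).2.
have bound n x : `|Re (f' n.+1 x) - Re (f' n x)| <=
      Num.sqrt (fine (G x)) * 2^-1 ^+ n /\
    `|Im (f' n.+1 x) - Im (f' n x)| <= Num.sqrt (fine (G x)) * 2^-1 ^+ n.
  have [Gx|Gx] := ltP (G x) +oo%E; last first.
    have xD : ~ D x by rewrite /D /= ltNge Gx.
    rewrite /f' /chi indicE memNset// !mul0r subrr normr0.
    by rewrite mulr_ge0 ?sqrtr_ge0 ?exprn_ge0.
  have sqb : Normc.normc (f' n.+1 x - f' n x) ^+ 2 <= fine (G x) * 4^-1 ^+ n.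
    rewrite /f' /chi indicE mem_set// !mul1r exprVn ler_pdivlMr ?exprn_gt0//.
    rewrite -lee_fin fineK ?ge0_fin_numE// mulrC.
    have -> : ((4 ^+ n * Normc.normc (f n.+1 x - f n x) ^+ 2)%:E = h n x)%E.
      by rewrite /h !nsqE !raddfB /= -sqrrN opprB -[in X in _ + X]sqrrN opprB.
    apply: le_trans (nneseries_lim_ge n.+1 (fun k _ _ => h0 k x)).
    by rewrite big_nat_recr//= leeDr// sume_ge0.
  have rhsE : (Num.sqrt (fine (G x)) * 2^-1 ^+ n) ^+ 2 = fine (G x) * 4^-1 ^+ n.
    rewrite exprMn sqr_sqrtr ?fine_ge0//; congr (_ * _).
    by rewrite -exprM mulnC exprM; congr (_ ^+ n); field.
  have rhs0 : 0 <= Num.sqrt (fine (G x)) * 2^-1 ^+ n.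
    by rewrite mulr_ge0 ?sqrtr_ge0 ?exprn_ge0.
  rewrite nsqE !raddfB /= in sqb.
  split; rewrite -ler_sqr ?nnegrE// rhsE real_normK ?num_real//.
    by apply: le_trans sqb; rewrite lerDl sqr_ge0.
  by apply: le_trans sqb; rewrite lerDr sqr_ge0.
have [g gsq fg] : exists2 g, sqint mu g &
    forall n, (csqnorm mu (fun x => f' n x - g x)%R <= (16^-1 ^+ n)%:E)%E.
  apply: csqnorm_cvg => // [n m nm|x|x].
  - rewrite (csqnorm_ae_eq (g := fun x => f n x - f m x)) ?fC//.
      by have [] := sqintB (f'sq n) (f'sq m).
    by apply: filterS2 (aef n) (aef m) => x -> ->.
  - by apply: (geometric_cvg (sqrtr_ge0 _)) => n; exact: (bound n x).1.
  - by apply: (geometric_cvg (sqrtr_ge0 _)) => n; exact: (bound n x).2.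
exists g => // n; rewrite (csqnorm_ae_eq (g := fun x => f' n x - g x)) ?fg//.
- by have [] := sqintB (fsq n) gsq.
- by have [] := sqintB (f'sq n) gsq.
- by apply: filterS (aef n) => x ->.
Qed.

End riesz_fischer.

(** * The Hilbert space of square integrable functions modulo null functions *)

Section L2_space.
Context d (T : measurableType d) (R : realType).
Variable mu : {measure set T -> \bar R}.
Local Notation C := R[i].
Local Notation conj := (@Num.conj C).
Local Notation sqint := (sqint mu).
Local Notation csqnorm := (csqnorm mu).
Local Notation cintegral := (cintegral mu).
Implicit Types f g h : T -> C.

(** The value 0 off the square integrable functions leaves only convergent integrals to distinguish
    two such functionals. *)
Definition pairing f : (T -> C) -> C :=
  fun g => if `[< sqint g >] then cintegral (fun x => f x * conj (g x)) else 0.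

Definition L2_pred : {pred (T -> C) -> C} :=
  fun phi => `[< exists2 f, sqint f & phi = pairing f >].

Lemma pairingP (a : C) f g : sqint f -> sqint g ->
  pairing (fun x => a * f x + g x) = a *: pairing f + pairing g.
Proof.
move=> hf hg; apply/funext => h.
rewrite -[RHS]/(a * pairing f h + pairing g h) /pairing.
case: asboolP => hh; last by rewrite mulr0 addr0.
rewrite -cintegralP; [|exact: cintegrableM..].
by congr (cintegral _); apply/funext => x; rewrite mulrDl mulrA.
Qed.

Lemma L2_submod_closed : submod_closed L2_pred.
Proof.
split=> [|a _ _ /asboolP[f hf ->] /asboolP[g hg ->]]; apply/asboolP; last first.
  by exists (fun x => a * f x + g x); [exact: sqintP|rewrite pairingP].
exists (fun=> 0); first exact: sqint0.
have := pairingP (-1) (sqint0 mu) (sqint0 mu); rewrite scaleN1r addNr => p0.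
by rewrite -[LHS]p0; congr pairing; apply/funext => x; rewrite mulr0 addr0.
Qed.

HB.instance Definition _ :=
  GRing.isSubmodClosed.Build _ _ L2_pred L2_submod_closed.

(* The class of f is encoded by the functional g |-> int f conj(g) on square
   integrable functions, which spares a quotient. *)
Record L2 := MkL2 { L2_val :> (T -> C) -> C; L2_valP : L2_val \in L2_pred }.

HB.instance Definition _ := [isSub for L2_val].
HB.instance Definition _ := [Choice of L2 by <:].
HB.instance Definition _ := [SubChoice_isSubLmodule of L2 by <:].

Definition L2_repr (phi : L2) : T -> C :=
  xget (fun=> 0) [set f | sqint f /\ (phi : (T -> C) -> C) = pairing f].

Lemma L2_reprP (phi : L2) :
  sqint (L2_repr phi) /\ (phi : (T -> C) -> C) = pairing (L2_repr phi).
Proof.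
have [f hf e] := asboolP _ (L2_valP phi).
by apply: (@xgetPex _ (fun=> 0) [set f | sqint f /\ (phi : _ -> _) = pairing f]); exists f.
Qed.

Definition L2_class f : L2 :=
  if pselect (sqint f) is left hf then
    MkL2 (asboolT (ex_intro2 _ (fun f => _ = pairing f) f hf erefl))
  else 0.

Lemma L2_classE f : sqint f -> (L2_class f : (T -> C) -> C) = pairing f.
Proof. by rewrite /L2_class; case: pselect. Qed.

Lemma L2_reprK (phi : L2) : L2_class (L2_repr phi) = phi.
Proof.
have [hf e] := L2_reprP phi.
by apply: val_inj; rewrite /= L2_classE.
Qed.

Lemma L2_classP (a : C) f g : sqint f -> sqint g ->
  L2_class (fun x => a * f x + g x) = a *: L2_class f + L2_class g.
Proof.
move=> hf hg; apply: val_inj => /=.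
by rewrite !L2_classE ?pairingP//; exact: sqintP.
Qed.

Lemma L2_class_ind (P : L2 -> Prop) :
  (forall f, sqint f -> P (L2_class f)) -> forall phi, P phi.
Proof. by move=> h phi; rewrite -(L2_reprK phi); apply/h/(L2_reprP phi).1. Qed.

Lemma L2_class_eq f g : sqint f -> sqint g ->
  {ae mu, forall x, f x = g x} -> L2_class f = L2_class g.
Proof.
move=> hf hg fg; apply: val_inj; rewrite /= !L2_classE//; apply/funext => h.
rewrite /pairing; case: asboolP => // hh.
apply/eqP; rewrite -subr_eq0 addrC -mulN1r -cintegralP; [|exact: cintegrableM..].
apply/eqP/cintegral_ae0; last by apply: filterS fg => x ->; rewrite mulN1r addNr.
have mh := cmeasurable_conj hh.1.
by apply: cmeasurableP; apply: cmeasurableM => //; [case: hg|case: hf].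
Qed.

Definition L2_dot (phi psi : L2) : C :=
  cintegral (fun x => L2_repr phi x * conj (L2_repr psi x)).

Lemma cintegral_mulC f g : sqint f -> sqint g ->
  cintegral (fun x => f x * conj (g x)) = conj (cintegral (fun x => g x * conj (f x))).
Proof.
move=> hf hg; rewrite -cintegral_conj; last exact: cintegrableM.
by congr (cintegral _); apply/funext => x; rewrite rmorphM /= conjCK mulrC.
Qed.

(** A chosen representative is known only through its functional. Hence [f] is exchanged for its
    representative against a fixed second argument, and then [g] for its own by conjugate
    symmetry. *)
Lemma L2_dotE f g : sqint f -> sqint g ->
  L2_dot (L2_class f) (L2_class g) = cintegral (fun x => f x * conj (g x)).
Proof.
move=> hf hg; rewrite /L2_dot.
have [hf' ef] := L2_reprP (L2_class f); have [hg' eg] := L2_reprP (L2_class g).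
move: ef eg; rewrite !L2_classE//; set f' := L2_repr _; set g' := L2_repr _.
move=> /(congr1 (fun p => p g')) + /(congr1 (fun p => p f)).
rewrite /pairing !asboolT// => <- e.
by rewrite cintegral_mulC// -e -cintegral_mulC.
Qed.

Lemma L2_dotC (phi psi : L2) : L2_dot phi psi = conj (L2_dot psi phi).
Proof. by rewrite /L2_dot cintegral_mulC//; apply: (L2_reprP _).1. Qed.

Lemma L2_dot_linearl (psi : L2) : linear_for *%R (L2_dot ^~ psi).
Proof.
move=> a phi chi; elim/L2_class_ind: phi => f hf; elim/L2_class_ind: chi => h hh.
elim/L2_class_ind: psi => g hg.
rewrite -L2_classP// !L2_dotE//; last exact: sqintP.
rewrite -cintegralP; [|exact: cintegrableM..].
by congr (cintegral _); apply/funext => x; rewrite mulrDl mulrA.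
Qed.

Lemma L2_dot_linearr (phi : L2) : linear_for (conj \; *%R) (L2_dot phi).
Proof.
move=> a psi chi; rewrite /= L2_dotC L2_dot_linearl rmorphD rmorphM /=.
by rewrite -!(L2_dotC phi).
Qed.

HB.instance Definition _ := bilinear_isBilinear.Build C L2 L2 C
  *%R (conj \; *%R) L2_dot (L2_dot_linearl, L2_dot_linearr).

Lemma L2_dot_hermitian (phi psi : L2) :
  L2_dot phi psi = (-1) ^+ false * conj (L2_dot psi phi).
Proof. by rewrite mul1r L2_dotC. Qed.

HB.instance Definition _ :=
  isHermitianSesquilinear.Build C L2 false conj L2_dot L2_dot_hermitian.

Definition L2_nsq (phi : L2) : R := fine (csqnorm (L2_repr phi)).

Lemma L2_dot_nsq (phi : L2) : L2_dot phi phi = (L2_nsq phi)%:C%C.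
Proof. by rewrite /L2_dot cintegral_nsq//; apply: (L2_reprP _).1. Qed.

Lemma L2_dot_gt0 (phi : L2) : phi != 0 -> 0 < L2_dot phi phi.
Proof.
move=> phi0; rewrite L2_dot_nsq lt0cR lt_neqAle fine_ge0 ?csqnorm_ge0// andbT.
have [[mf f2] _] := L2_reprP phi.
apply: contra phi0 => /eqP /esym f0.
have {}f0 : csqnorm (L2_repr phi) = 0%E.
  by rewrite -[LHS]fineK ?ge0_fin_numE ?csqnorm_ge0// [fine _]f0.
rewrite -[phi]L2_reprK; apply/eqP.
(* Two functions that agree wherever the representative vanishes; by linearity their classes are
   [phi] and 0. *)
have := @L2_class_eq (fun x => 0 * L2_repr phi x + L2_repr phi x)
  (fun x => -1 * L2_repr phi x + L2_repr phi x).
rewrite !L2_classP// scale0r add0r scaleN1r addNr; apply; do ?exact: sqintP.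
by apply: filterS (csqnorm_eq0 mf f0) => x ->; rewrite !mulr0.
Qed.

HB.instance Definition _ := isDotProduct.Build C L2 L2_dot L2_dot_gt0.

Definition L2_inner : {dot L2 for conj} := L2_dot.

HB.instance Definition _ := Lmodule_isNormed.Build C L2
  (dot_triangle L2_inner) (dot_normZ L2_inner) (@dot_norm_eq0 _ _ L2_inner).

Lemma L2_normE (phi : L2) : `|phi| ^+ 2 = (L2_nsq phi)%:C%C.
Proof. by rewrite -L2_dot_nsq -[LHS]/(dot_norm L2_inner phi ^+ 2) sqrtCK. Qed.

Lemma L2_nsqE f : sqint f -> (L2_nsq (L2_class f))%:E = csqnorm f.
Proof.
move=> hf; have : (L2_nsq (L2_class f))%:C%C = (fine (csqnorm f))%:C%C.
  by rewrite -L2_dot_nsq L2_dotE// cintegral_nsq.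
by move=> /complexI ->; rewrite fineK// ge0_fin_numE ?csqnorm_ge0//; exact: hf.2.
Qed.

Lemma L2_classB f g : sqint f -> sqint g ->
  L2_class (fun x => f x - g x) = L2_class f - L2_class g.
Proof.
move=> hf hg; rewrite addrC -scaleN1r -L2_classP//.
by congr L2_class; apply/funext => x; rewrite mulN1r addrC.
Qed.

Lemma L2_complete (F : set_system L2) : ProperFilter F -> cauchy F -> cvg F.
Proof.
apply: (complete_of_sequences L2_normE) => u uC.
have [f hf uE] : exists2 f : nat -> T -> C, (forall n, sqint (f n)) &
    forall n, u n = L2_class (f n).
  exists (fun n => L2_repr (u n)) => n; first exact: (L2_reprP (u n)).1.
  by rewrite L2_reprK.
have [n m nm|g hg fg] := riesz_fischer hf.
  rewrite -L2_nsqE; last exact: sqintB.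
  by rewrite L2_classB// -!uE lee_fin ltW// uC.
exists (L2_class g) => e e0.
have [M Me] := @expr_small R 16^-1 e ltac:(lra) ltac:(lra) e0.
exists M => n Mn; apply: le_lt_trans (Me n Mn).
by rewrite uE -L2_classB// -lee_fin L2_nsqE ?fg//; exact: sqintB.
Qed.

HB.instance Definition _ := Uniform_isComplete.Build L2 L2_complete.

HB.instance Definition _ := CompleteNormedModule_isHilbert.Build R L2
  (fun phi : L2 => esym (sqrtCK (L2_inner phi phi))).

Lemma hnsq_L2_class f : sqint f -> (hnsq (L2_class f))%:E = csqnorm f.
Proof.
by move=> hf; rewrite -L2_nsqE// /hnsq -[inner _ _]/(L2_dot _ _) L2_dot_nsq.
Qed.

Lemma inner_L2_class f g : sqint f -> sqint g ->
  inner (L2_class f) (L2_class g) = cintegral (fun x => f x * conj (g x)).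
Proof. exact: L2_dotE. Qed.

(** The bound makes [A] well defined on classes: applied to the difference of [f] and the chosen
    representative of its class, it yields a function of norm 0. *)
Lemma L2_lift (A : (T -> C) -> T -> C) (c : R) :
  (forall f, cmeasurable f -> cmeasurable (A f)) ->
  (forall f, sqint f -> (csqnorm (A f) <= c%:E * csqnorm f)%E) ->
  (forall (a : C) f g x, A (fun y => a * f y + g y) x = a * A f x + A g x) ->
  exists L : {linear L2 -> L2}, forall f, sqint f ->
    sqint (A f) /\ L (L2_class f) = L2_class (A f).
Proof.
move=> mA bA lA.
have sA f : sqint f -> sqint (A f).
  move=> hf; split; first exact: mA hf.1.
  have c0 : (c%:E <= `|c|%:E)%E by rewrite lee_fin ler_norm.
  apply: le_lt_trans (bA f hf) _; rewrite -[csqnorm f]fineK.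
    by rewrite -EFinM ltry.
  by rewrite ge0_fin_numE ?csqnorm_ge0//; exact: hf.2.
pose L (phi : L2) := L2_class (A (L2_repr phi)).
have LE f : sqint f -> L (L2_class f) = L2_class (A f).
  move=> hf; apply/eqP; rewrite -subr_eq0; apply/eqP/hnsq_eq0.
  have [hg _] := L2_reprP (L2_class f).
  have AB : L2_class (A (L2_repr (L2_class f))) - L2_class (A f) =
      L2_class (A (fun x => L2_repr (L2_class f) x - f x)).
    rewrite addrC -scaleN1r -L2_classP; do ?exact: sA.
    congr L2_class; apply/funext => x; rewrite -lA; congr (A _ _).
    by apply/funext => y; rewrite mulN1r addrC.
  rewrite /L AB; apply/eqP; rewrite eq_le hnsq_ge0 andbT -lee_fin.
  have hB := sqintB hg hf.
  rewrite hnsq_L2_class; last exact: sA.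
  apply: (le_trans (bA _ hB)).
  rewrite -hnsq_L2_class// L2_classB// L2_reprK subrr.
  by rewrite /hnsq inner0l /= mule0.
have LL : linear L.
  move=> a phi psi; elim/L2_class_ind: phi => f hf; elim/L2_class_ind: psi => g hg.
  rewrite -L2_classP// !LE//; last exact: sqintP.
  by rewrite -L2_classP; do ?[exact: sA]; congr L2_class; apply/funext => x; exact: lA.
pose Lin : {linear L2 -> L2} := HB.pack L (GRing.isLinear.Build _ _ _ _ L LL).
by exists Lin => f hf; split; [exact: sA|exact: LE].
Qed.

Lemma L2_isometry (A : (T -> C) -> T -> C) :
  (forall f, cmeasurable f -> cmeasurable (A f)) ->
  (forall f, cmeasurable f -> csqnorm (A f) = csqnorm f) ->
  (forall (a : C) f g x, A (fun y => a * f y + g y) x = a * A f x + A g x) ->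
  exists2 U : {linear L2 -> L2}, (forall p, hnsq (U p) = hnsq p) &
    forall f, sqint f -> sqint (A f) /\ U (L2_class f) = L2_class (A f).
Proof.
move=> mA Aiso lA; have [f hf|U UE] := @L2_lift A 1 mA _ lA.
  by rewrite mul1e Aiso//; exact: hf.1.
exists U => // p; elim/L2_class_ind: p => f hf; have [sf ->] := UE f hf.
have e := etrans (hnsq_L2_class sf) (etrans (Aiso f hf.1) (esym (hnsq_L2_class hf))).
exact: (EFin_inj e).
Qed.

(** The bound by 1 gives a contraction, real values give symmetry, and strict positivity gives
    injectivity. *)
Lemma L2_multiplier (b : T -> R) : measurable_fun setT b ->
  (forall x, 0 < b x) -> (forall x, b x <= 1) ->
  exists B : {linear L2 -> L2}, [/\ forall p q, inner (B p) q = inner p (B q),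
    injective B & forall f, sqint f -> sqint (fun x => (b x)%:C%C * f x) /\
      B (L2_class f) = L2_class (fun x => (b x)%:C%C * f x)].
Proof.
move=> mb b0 b1; pose A f x := (b x)%:C%C * f x.
have mA f : cmeasurable f -> cmeasurable (A f).
  by move=> mf; apply: cmeasurableM => //; split.
have [f hf|a f g x|B BE] := @L2_lift A 1 mA.
- rewrite mul1e; apply: ge0_le_integral => //.
  + by move=> x _; rewrite lee_fin sqr_ge0.
  + by apply: cmeasurable_nsq; apply: mA; exact: hf.1.
  + by apply: cmeasurable_nsq; exact: hf.1.
  move=> x _; rewrite lee_fin Normc.normcM exprMn ler_piMl ?sqr_ge0// nsqE /=.
  by rewrite expr0n addr0 exprn_ile1// ltW.
- by rewrite /A mulrDr mulrCA.
exists B; split=> // p q; elim/L2_class_ind: p => f hf; elim/L2_class_ind: q => g hg.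
  have [[sf ->] [sg ->]] := (BE f hf, BE g hg).
  rewrite !inner_L2_class//; congr cintegral; apply/funext => x.
  rewrite /A rmorphM /=.
  have -> : conj (b x)%:C%C = (b x)%:C%C by rewrite -[LHS]/((b x)%:C^*)%C conjc_real.
  by rewrite -mulrA mulrCA.
have [[sf ->] [sg ->]] := (BE f hf, BE g hg).
move=> /eqP; rewrite -subr_eq0 -L2_classB// => /eqP fg0.
have hfg := sqintB sf sg.
have := hnsq_L2_class hfg; rewrite fg0 {1}/hnsq inner0l => /esym.
move=> /(csqnorm_eq0 hfg.1) ae0; apply: L2_class_eq => //.
apply: filterS ae0 => x; rewrite /A -mulrBr => /eqP.
rewrite mulf_eq0 subr_eq0 => /orP[|/eqP//].
by rewrite eq_complex /= gt_eqF.
Qed.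

End L2_space.

(** * Sums and densities of measures *)

Lemma esum_swap (R : realType) (I J : choiceType) (D : set I) (E : set J)
    (a : I -> J -> \bar R) :
  (forall i j, D i -> E j -> (0 <= a i j)%E) ->
  (\esum_(i in D) \esum_(j in E) a i j = \esum_(j in E) \esum_(i in D) a i j)%E.
Proof.
move=> a0; rewrite !esum_esum//; last by move=> i j Ei Dj; exact: a0.
rewrite [RHS](@reindex_esum R _ _ (D `*`` (fun=> E)) (E `*`` (fun=> D))
  (fun p => (p.2, p.1)) (fun k => a k.2 k.1))//.
split => [p [Dp Ep]|p q _ _ [e1 e2]|[j i] [Ej Di]].
- by split.
- by case: p q e1 e2 => [? ?] [? ?] /= -> ->.
- by exists (i, j).
Qed.

Lemma ge0_esumZl (R : realType) (I : choiceType) (D : set I) (c : R)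
    (a : I -> \bar R) : 0 <= c -> (forall i, D i -> (0 <= a i)%E) ->
  (\esum_(i in D) (c%:E * a i) = c%:E * \esum_(i in D) a i)%E.
Proof.
move=> c0 a0; rewrite /esum -ereal_supZl//; last first.
  by apply/set0P; exists (\sum_(i \in set0) a i)%E; exists set0 => //;
     exact: fsets_set0.
congr ereal_sup; rewrite image_comp; apply: eq_imagel => A [fA AD] /=.
rewrite !fsbig_finite//= big_seq [in RHS]big_seq ge0_sume_distrr// => i.
by rewrite in_fset_set// => /set_mem /AD; exact: a0.
Qed.

Section sum_measure.
Context d (T : measurableType d) (R : realType) (I : choiceType).
Variables (D : set I) (m : I -> {measure set T -> \bar R}).

(** The sum is unordered because the index set, later the vertices or the children of one vertex,
    may be uncountable. *)
Definition msume (A : set T) : \bar R := (\esum_(i in D) m i A)%E.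

Let msume0 : msume set0 = 0%E.
Proof. by rewrite /msume esum1// => i _; rewrite measure0. Qed.

Let msume_ge0 A : (0 <= msume A)%E.
Proof. exact: esum_ge0. Qed.

Let msume_sigma_additive : semi_sigma_additive msume.
Proof.
move=> F mF tF mUF.
rewrite [X in _ --> X](_ : _ = (\sum_(k <oo) msume (F k))%E).
  by apply: is_cvg_ereal_nneg_natsum => k _; exact: msume_ge0.
rewrite nneseries_esumT; last by move=> k; exact: msume_ge0.
rewrite /msume esum_swap//; apply: eq_esum => i _.
by rewrite measure_semi_bigcup// nneseries_esumT.
Qed.

HB.instance Definition _ := isMeasure.Build _ _ _ msume
  msume0 msume_ge0 msume_sigma_additive.

Import HBNNSimple.

(** For the upper bound, the integral of a simple function is a finite sum, which commutes with the
    unordered one. *)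
Lemma integral_msume (f : T -> \bar R) :
  (forall x, (0 <= f x)%E) -> measurable_fun setT f ->
  (\int[msume]_x f x = \esum_(i in D) \int[m i]_x f x)%E.
Proof.
move=> f0 mf; apply/eqP; rewrite eq_le; apply/andP; split.
  rewrite ge0_integralTE//; apply: ge_ereal_sup => _ [h hf <-].
  have -> : sintegral msume h = (\esum_(i in D) sintegral (m i) h)%E.
    rewrite sintegralE fsbig_finite//=.
    under [RHS]eq_esum do rewrite sintegralE fsbig_finite//=.
    rewrite esum_sum => [|i x _ _]; last first.
      exact: nnsfun_mulemu_ge0.
    rewrite big_seq [RHS]big_seq; apply: eq_bigr => x.
    rewrite in_fset_set// => /set_mem[t _ <-].
    by rewrite ge0_esumZl.
  apply: le_esum => i _; rewrite ge0_integralTE//.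
  by apply: ereal_sup_ubound; exists h.
(* Lower bound: a finite partial sum is the integral against a finite sum of the measures, and that
   sum is dominated by [msume]. *)
apply: ge_ereal_sup => _ [A [fA AD] <-].
rewrite fsbig_finite//=.
have := finmap.fset_uniq (fset_set A).
have : {subset finmap.enum_fset (fset_set A) <= D}.
  by move=> i; rewrite in_fset_set// => /set_mem /AD /mem_set.
move: (finmap.enum_fset _) => [|i0 s] sD us.
  by rewrite big_nil integral_ge0.
rewrite (big_nth i0) big_mkord.
rewrite -(@ge0_integral_measure_sum _ _ _ (fun k => m (nth i0 (i0 :: s) k)))//.
apply: ge0_le_measure_integral => // B mB.
rewrite -[leLHS]/(\sum_(k < size (i0 :: s)) m (nth i0 (i0 :: s) k) B)%E.
rewrite -(big_mkord xpredT (fun k => m (nth i0 (i0 :: s) k) B)).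
rewrite -(big_nth i0 xpredT (fun i => m i B)) fsbig_seq//.
by apply: ereal_sup_ubound; exists [set` i0 :: s] => //; split=> // i /sD /set_mem.
Qed.

End sum_measure.

Section fibers.
Context d (T : measurableType d) (V : choiceType) (v0 : V).

(* The disjoint union of copies of T indexed by V; the base point v0 is only
   needed because measurable types are pointed. *)
Definition fibers (v : V) : Type := (V * T)%type.

Local Notation X := (fibers v0).

HB.instance Definition _ := Choice.on X.
HB.instance Definition _ := isPointed.Build X (v0, point).

(** The largest sigma-algebra making all inclusions of fibres measurable. Measurability is thus
    checked fibre by fibre, however many vertices there are. *)
Definition fiber_measurable : set (set X) :=
  [set A | forall v, measurable [set s : T | A (v, s)]].

Let fiber_measurable0 : fiber_measurable set0.
Proof. by move=> v; exact: measurable0. Qed.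

Let fiber_measurableC A : fiber_measurable A -> fiber_measurable (~` A).
Proof. by move=> mA v; exact: (measurableC (mA v)). Qed.

Let fiber_measurable_bigcup (F : (set X)^nat) :
  (forall i, fiber_measurable (F i)) -> fiber_measurable (\bigcup_i F i).
Proof.
move=> mF v; rewrite (_ : [set s | _] = \bigcup_i [set s | F i (v, s)])//.
by apply: bigcup_measurable => i _; exact: mF.
Qed.

HB.instance Definition _ := @isMeasurable.Build d X fiber_measurable
  fiber_measurable0 fiber_measurableC fiber_measurable_bigcup.

Definition fiber (v : V) (s : T) : X := (v, s).

Lemma measurable_fiber v : measurable_fun setT (fiber v).
Proof. by move=> _ A mA; rewrite setTI; exact: mA. Qed.

Lemma fibers_measurable_fun d' (T' : measurableType d') (f : X -> T') :
  (forall v, measurable_fun setT (f \o fiber v)) -> measurable_fun setT f.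
Proof.
move=> mf _ A mA; rewrite setTI; suff : fiber_measurable (f @^-1` A) by [].
move=> v.
by have := mf v measurableT A mA; rewrite setTI.
Qed.

Variables (R : realType) (m : V -> {measure set T -> \bar R}).

Definition fiber_pushforward v : {measure set X -> \bar R} :=
  measure_function_pushforward__canonical__measure_function_Measure
    (m v) (measurable_fiber v).

Definition fiber_measure : set X -> \bar R := msume setT fiber_pushforward.

HB.instance Definition _ := Measure.on fiber_measure.

Lemma integral_fiber_measure (f : X -> \bar R) :
  (forall x, (0 <= f x)%E) -> measurable_fun setT f ->
  (\int[fiber_measure]_x f x = \esum_(v in setT) \int[m v]_s f (v, s))%E.
Proof.
move=> f0 mf; rewrite integral_msume//; apply: eq_esum => v _.
have := ge0_integral_pushforward (measurable_fiber v) (m v) measurableT mf.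
by rewrite preimage_setT; apply => x _; exact: f0.
Qed.

End fibers.

Section density.
Context d (T : measurableType d) (R : realType).
Variables (m : {measure set T -> \bar R}) (w : T -> R).
Hypotheses (w0 : forall x, 0 <= w x) (mw : measurable_fun setT w).

Definition density (A : set T) : \bar R := (\int[m]_(x in A) (w x)%:E)%E.

Let density0 : density set0 = 0%E.
Proof. exact: integral_set0. Qed.

Let density_ge0 A : (0 <= density A)%E.
Proof. by apply: integral_ge0 => x _; rewrite lee_fin. Qed.

Let density_sigma_additive : semi_sigma_additive density.
Proof.
move=> F mF tF mUF.
rewrite /density ge0_integral_bigcup//.
- apply: is_cvg_ereal_nneg_natsum => k _; exact: density_ge0.
- exact/measurable_funTS/measurable_EFinP.
- by move=> x _; rewrite lee_fin.
Qed.

HB.instance Definition _ := isMeasure.Build _ _ _ density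
  density0 density_ge0 density_sigma_additive.

Definition density_measure : {measure set T -> \bar R} := density.

Import HBNNSimple.

Lemma integral_density_nnsfun (h : {nnsfun T >-> R}) :
  (\int[density_measure]_x (h x)%:E = \int[m]_x ((w x)%:E * (h x)%:E))%E.
Proof.
rewrite integralT_nnsfun sintegralE fsbig_finite//=.
(* The absolute value makes [g] nonnegative for every real [y]; it changes nothing on the range of
   [h]. *)
pose g y x := (`|y|%:E * ((w x)%:E * (\1_(h @^-1` [set y]) x)%:E))%E.
have g0 y x : (0 <= g y x)%E.
  by rewrite !mule_ge0// lee_fin// indicE.
have mg0 y : measurable_fun setT (fun x => (w x)%:E * (\1_(h @^-1` [set y]) x)%:E)%E.
  apply: emeasurable_funM; first exact/measurable_EFinP.
  by apply/measurable_EFinP; exact: measurable_indic.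
have mg y : measurable_fun setT (g y) by exact: measurable_funeM.
transitivity (\sum_(y <- finmap.enum_fset (fset_set (range h))) \int[m]_x g y x)%E.
  rewrite big_seq [RHS]big_seq; apply: eq_bigr => y.
  rewrite in_fset_set// => /set_mem[t _ <-].
  rewrite ge0_integralZl_EFin//; last by move=> x _; rewrite mule_ge0// lee_fin// indicE.
  rewrite ger0_norm//; congr (_ * _)%E.
  rewrite -[LHS]/(density _) /density integral_mkcond.
  by rewrite epatch_indic.
rewrite -ge0_integral_sum//; apply: eq_integral => x _.
rewrite fimfunE fsbig_finite//= -sumEFin.
rewrite [in RHS](eq_big_seq (F1 := fun y => (y * \1_(h @^-1` [set y]) x)%:E)
  (fun y => (`|y| * \1_(h @^-1` [set y]) x)%:E)); last first.
  by move=> y; rewrite in_fset_set// => /set_mem[t _ <-]; rewrite ger0_norm.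
rewrite ge0_sume_distrr => [|y _]; last by rewrite lee_fin mulr_ge0// indicE.
by apply: eq_bigr => y _; rewrite /g EFinM muleCA.
Qed.

(** Monotone convergence along the simple approximations, on both sides. *)
Lemma integral_density (f : T -> \bar R) :
  (forall x, (0 <= f x)%E) -> measurable_fun setT f ->
  (\int[density_measure]_x f x = \int[m]_x ((w x)%:E * f x))%E.
Proof.
move=> f0 mf; pose f_ := nnsfun_approx measurableT mf.
have nd x : {homo (fun n => (f_ n x)%:E) : a b / (a <= b)%N >-> (a <= b)%E}.
  by move=> a b ab; rewrite lee_fin; exact/lefP/nd_nnsfun_approx.
have mf_ n : measurable_fun setT (fun x => (f_ n x)%:E) by exact/measurable_EFinP.
have cf x : (f_ n x)%:E @[n --> \oo] --> f x by exact: cvg_nnsfun_approx.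
have mw' : measurable_fun setT (fun x => (w x)%:E) by exact/measurable_EFinP.
have f_0 n x : (0 <= (f_ n x)%:E)%E by rewrite lee_fin.
have -> : (\int[density_measure]_x f x =
    limn (fun n => \int[density_measure]_x (f_ n x)%:E))%E.
  rewrite -monotone_convergence//.
  by apply: eq_integral => x _; apply/esym/cvg_lim.
have -> : (\int[m]_x ((w x)%:E * f x) =
    limn (fun n => \int[m]_x ((w x)%:E * (f_ n x)%:E)))%E.
  rewrite -monotone_convergence//.
  - apply: eq_integral => x _; apply/esym/cvg_lim => //.
    by apply: cvgeZl.
  - by move=> n; exact: emeasurable_funM.
  - by move=> n x _; rewrite mule_ge0// lee_fin.
  - by move=> x _ a b ab; rewrite lee_wpmul2l// ?lee_fin//; exact: nd.
by congr (limn _); apply/funext => n; exact: integral_density_nnsfun.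
Qed.

End density.

(** * Weighted shifts on directed trees *)

Section tree.
Context (R : realType) (V : choiceType) (T : directed_tree V).

Lemma parentE u v : edge T u v -> parent T v = u.
Proof.
move=> uv; rewrite /parent; case: xgetP => [w _ wv|/(_ u)//].
exact: tree_parent_unique wv uv.
Qed.

Lemma edge_nonroot u v : edge T u v -> v \in nonroots T.
Proof. by move=> uv; apply/mem_set => /(_ u); rewrite uv. Qed.

(** The sets of children partition the vertices other than the root, so the sum is regrouped by
    parents. *)
Lemma esum_children (a : V -> V -> \bar R) : (forall u v, (0 <= a u v)%E) ->
  (\esum_(v in nonroots T) a (parent T v) v =
   \esum_(u in setT) \esum_(v in children T u) a u v)%E.
Proof.
move=> a0; rewrite esum_esum//.
rewrite (@reindex_esum R _ _ (setT `*`` children T) (nonroots T) snd); last first.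
  split=> [[u v] /= [_ uv]|[u v] [u' v'] + + /= vv'|v].
  - exact/set_mem/(edge_nonroot uv).
  - rewrite vv' !inE => -[_ /= uv] [_ /= u'v].
    by congr pair; exact: tree_parent_unique uv u'v.
  - by move=> /existsNP[u /negP]; rewrite negbK => uv; exists (u, v).
by apply: eq_esum => -[u v] [_ /= /parentE ->].
Qed.

End tree.

(** * The phase of the shift over a consistent system, and the normal extension *)

Section consistent_system.
Context (R : realType) (V : choiceType) (T : directed_tree V) (lambda : V -> R[i]).
Variable mu : V -> probability (measurableTypeR R) R.
Hypothesis mu_Rplus : forall v : V, mu v `[0, +oo[%classic = 1%E.
Variable eps : V -> R.
Hypothesis consistency : forall (u : V) (sigma : set (measurableTypeR R)),
  measurable sigma -> sigma `<=` `[0, +oo[%classic ->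
  (mu u sigma =
     \esum_(v in children T u)
        ((Normc.normc (lambda v) ^+ 2)%:E *
         \int[mu v]_(s in sigma) (s%:E)^-1)
     + (eps u)%:E * \d_(0%R : measurableTypeR R) sigma)%E.
Local Notation Rm := (measurableTypeR R).
Local Notation P := (`]0, +oo[%classic : set Rm).
Local Notation chi := (\1_P : Rm -> R).

Lemma measurable_inv_pos : measurable_fun setT (fun s : Rm => chi s / s).
Proof.
rewrite (_ : (fun _ => _) = (fun s : Rm => chi s * s `^ (-1))); last first.
  apply/funext => s; rewrite indicE.
  case: (boolP (s \in _)) => sP; last by rewrite !mul0r.
  by rewrite powR_inv1//; move: sP; rewrite inE /= in_itv /= andbT => /ltW.
apply: measurable_funM; last exact: measurable_powR.
by apply: measurable_indic; exact: measurable_itv.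
Qed.

Lemma measurable_chi : measurable_fun setT chi.
Proof. by apply: measurable_indic; exact: measurable_itv. Qed.

Lemma chi_div_ge0 s : 0 <= chi s / s.
Proof.
rewrite indicE; case: (boolP (s \in _)) => [|_]; last by rewrite mul0r.
by rewrite inE /= in_itv /= andbT => s0; rewrite mul1r invr_ge0 ltW.
Qed.

(* For s > 0 the consistency condition reads s dmu_u = sum |lambda_v|^2 dmu_v. *)
Lemma integral_consistent u (g : Rm -> \bar R) :
  (forall s, (0 <= g s)%E) -> measurable_fun setT g ->
  (\int[mu u]_s ((chi s)%:E * g s) =
   \esum_(v in children T u)
     \int[mu v]_s ((Normc.normc (lambda v) ^+ 2 * (chi s / s))%:E * g s))%E.
Proof.
move=> g0 mg.
have chi0 s : 0 <= chi s by rewrite indicE.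
have w0 v s : 0 <= Normc.normc (lambda v) ^+ 2 * (chi s / s).
  by rewrite mulr_ge0 ?sqr_ge0// chi_div_ge0.
have mw v : measurable_fun setT (fun s : Rm => Normc.normc (lambda v) ^+ 2 * (chi s / s)).
  by apply: measurable_funM => //; exact: measurable_inv_pos.
rewrite -(integral_density (mu u) chi0 measurable_chi g0 mg).
under eq_esum do rewrite -(integral_density (mu _) (w0 _) (mw _) g0 mg).
rewrite -(integral_msume (children T u)
  (fun v => density_measure (mu v) (w0 v) (mw v)) g0 mg).
apply: eq_measure_integral => A mA _.
rewrite -[LHS]/(density (mu u) chi A).
rewrite -[RHS]/(\esum_(v in children T u) density (mu v) _ A)%E.
have mAP : measurable (A `&` P) by apply: measurableI => //; exact: measurable_itv.
have -> : density (mu u) chi A = mu u (A `&` P).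
  by rewrite /density integral_indic// setIC.
(* Intersecting with [P] removes 0, and with it the Dirac term and the infinite value of 1/s. *)
rewrite consistency//; last first.
  by move=> s [_] /=; rewrite !in_itv /= !andbT; exact: ltW.
rewrite diracE memNset; last by move=> [_] /=; rewrite in_itv /= ltxx.
rewrite mule0 adde0; apply: eq_esum => v _.
rewrite /density; under [RHS]eq_integral do rewrite EFinM.
rewrite ge0_integralZl_EFin ?sqr_ge0//; last 2 first.
- by move=> s _; rewrite lee_fin chi_div_ge0.
- by apply: measurable_funTS; apply/measurable_EFinP; exact: measurable_inv_pos.
rewrite integral_mkcondr; congr (_ * _)%E; apply: eq_integral => s _.
rewrite /patch indicE; case: ifPn => sP; last by rewrite mul0r.
rewrite mul1r inver; case: eqP => // s0.
by move: sP; rewrite s0 inE /= in_itv /= ltxx.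
Qed.

(** An atom of [mu v] at 0 would contribute |lambda_v|^2 times oo to the consistency condition at
    {0}, whose left side is at most 1. The negative half-line is null by [mu_Rplus]. *)
Lemma mu_off_pos u v : edge T u v -> lambda v != 0 -> mu v (~` P) = 0%E.
Proof.
move=> uv l0; have mP : measurable P by exact: measurable_itv.
have m0 : measurable ([set 0] : set Rm) by exact: measurable_set1.
have mu0 : mu v [set 0] = 0%E.
  apply/eqP/negPn/negP => mv0.
  have s0 : [set (0 : Rm)] `<=` `[0, +oo[ by move=> _ ->; rewrite /= in_itv /= lexx.
  have := consistency u m0 s0.
  rewrite [X in (_ = X + _)%E -> _](_ : _ = +oo%E); last first.
    apply/eqP; rewrite -leye_eq.
    have -> : (+oo = (Normc.normc (lambda v) ^+ 2)%:E *
        \int[mu v]_(s in [set (0%R : Rm)]) (s%:E)^-1)%E.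
      rewrite (eq_integral (cst +oo%E)); last first.
        by move=> s; rewrite inE => ->; rewrite inve0.
      rewrite integral_cst// gt0_mulye ?gt0_muley// ?lt0e ?mv0 ?measure_ge0//.
      by rewrite -lt0e lte_fin normc_sq_gt0.
    apply: esum_ge; exists [set v]; first by split => // _ ->.
    by rewrite fsbig_set1.
  have : (mu u [set 0%R] <= 1)%E by exact: probability_le1.
  by move=> + e; rewrite e addye ?leye_eq.
have -> : ~` P = ~` `[0, +oo[%classic `|` [set 0].
  apply/seteqP; split=> s /=; rewrite !in_itv /= !andbT.
    move=> /negP; rewrite -leNgt => s0.
    by case: (ltgtP s 0) s0 => // [s0|->] _; [left|right].
  by move=> [/negP + |->]; rewrite ?ltxx// -ltNge => s0; rewrite ltNge ltW.
apply/eqP; rewrite -measure_le0 (le_trans (measureU2 _ _ _))//.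
- by apply: measurableC; exact: measurable_itv.
have mI : measurable (`[0, +oo[%classic : set Rm) by exact: measurable_itv.
have := probability_setC (mu v) mI; rewrite mu_Rplus subee// => muI.
by rewrite [leLHS](_ : _ = 0%E)// -[LHS]/(mu v (~` _) + mu v _)%E muI mu0 adde0.
Qed.

Variable v0 : V.
Local Notation X := (fibers Rm v0).
Local Notation C := R[i].
Local Notation muX :=
  (@fiber_measure _ Rm V v0 R (fun v => mu v : {measure set Rm -> \bar R})).
Implicit Types F : X -> C.

Lemma cmeasurable_fiberP F :
  cmeasurable F <-> forall v, cmeasurable (fun s : Rm => F (v, s)).
Proof.
split=> [[mr mi] v|mF]; split.
- exact: (measurableT_comp mr (measurable_fiber v)).
- exact: (measurableT_comp mi (measurable_fiber v)).
- by apply: fibers_measurable_fun => v; exact: (mF v).1.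
- by apply: fibers_measurable_fun => v; exact: (mF v).2.
Qed.

Lemma csqnorm_fibers F : cmeasurable F ->
  csqnorm muX F = (\esum_(v in setT) csqnorm (mu v) (fun s => F (v, s)))%E.
Proof.
move=> mF; rewrite /csqnorm integral_fiber_measure//.
  by move=> x; rewrite lee_fin sqr_ge0.
exact: cmeasurable_nsq.
Qed.

(** The value 0 at the root cancels the default value of [parent] there. *)
Definition cweight v : C := if v \in nonroots T then lambda v else 0.

Definition shift_phase F (x : X) : C :=
  cweight x.1 * (chi x.2 / Num.sqrt x.2)%:C%C * F (parent T x.1, x.2) +
  (1 - chi x.2)%:C%C * F x.

(** No cross term arises, because for each [s] one of the two summands of [shift_phase] vanishes. *)
Lemma nsq_shift_phase F v s :
  Normc.normc (shift_phase F (v, s)) ^+ 2 =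
  Normc.normc (cweight v) ^+ 2 * (chi s / s) *
    Normc.normc (F (parent T v, s)) ^+ 2 +
  (1 - chi s) * Normc.normc (F (v, s)) ^+ 2.
Proof.
rewrite /shift_phase /= indicE; case: (boolP (s \in _)) => sP /=; last first.
  by rewrite !mul0r mulr0 mul0r mulr0 mul0r !add0r subr0 !mul1r.
rewrite subrr !mul0r !addr0 !mul1r !Normc.normcM !exprMn; congr (_ * _ * _).
rewrite nsqE /= expr0n addr0 exprVn sqr_sqrtr//.
by move: sP; rewrite inE /= in_itv /= andbT => /ltW.
Qed.

Lemma measurable_sqrt : measurable_fun setT (fun s : Rm => Num.sqrt s : R).
Proof. by apply: continuous_measurable_fun; exact: sqrt_continuous. Qed.

Lemma cmeasurable_real (k : Rm -> R) :
  measurable_fun setT k -> cmeasurable (fun s : Rm => (k s)%:C%C).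
Proof. by move=> mk; split. Qed.

Lemma measurable_inv_ge0 (k : Rm -> R) : (forall s, 0 <= k s) ->
  measurable_fun setT k -> measurable_fun setT (fun s => (k s)^-1).
Proof.
move=> k0 mk; rewrite (_ : (fun _ => _) = (fun s => k s `^ (-1))).
  exact: (measurableT_comp (measurable_powR (-1)) mk).
by apply/funext => s; rewrite powR_inv1.
Qed.

Lemma cmeasurable_shift_phase F : cmeasurable F -> cmeasurable (shift_phase F).
Proof.
move=> /cmeasurable_fiberP mF; apply/cmeasurable_fiberP => v.
have m1 : cmeasurable (fun s : Rm => (chi s / Num.sqrt s)%:C%C * F (parent T v, s)).
  apply: cmeasurableM => //; apply: cmeasurable_real.
  apply: measurable_funM; first exact: measurable_chi.
  by apply: measurable_inv_ge0 => //; exact: measurable_sqrt.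
have m2 : cmeasurable (fun s : Rm => (1 - chi s)%:C%C * F (v, s)).
  apply: cmeasurableM => //; apply: cmeasurable_real.
  by apply: measurable_funB => //; exact: measurable_chi.
have := cmeasurableP (cweight v) m1 m2.
by under eq_fun do rewrite mulrA.
Qed.

(** Regrouped by parents, the shifted terms over the children of [u] add up by consistency to the
    integral of |F(u, s)|^2 over s > 0; the unshifted term supplies the part over s <= 0. *)
Lemma shift_phase_isometric F : cmeasurable F ->
  csqnorm muX (shift_phase F) = csqnorm muX F.
Proof.
move=> mF; rewrite !csqnorm_fibers//; last exact: cmeasurable_shift_phase.
have mFv v : measurable_fun setT (fun s : Rm => (Normc.normc (F (v, s)) ^+ 2)%:E).
  by apply: cmeasurable_nsq; exact: ((cmeasurable_fiberP F).1 mF).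
have Fv0 v s : (0 <= (Normc.normc (F (v, s)) ^+ 2)%:E)%E by rewrite lee_fin sqr_ge0.
have chi0 s : 0 <= chi s by rewrite indicE.
have chi1 s : 0 <= 1 - chi s by rewrite subr_ge0 indicE; case: (_ \in _).
pose I1 u v := (\int[mu v]_s ((Normc.normc (lambda v) ^+ 2 * (chi s / s))%:E *
  (Normc.normc (F (u, s)) ^+ 2)%:E))%E.
pose I2 v := (\int[mu v]_s ((1 - chi s)%:E * (Normc.normc (F (v, s)) ^+ 2)%:E))%E.
have I10 u v : (0 <= I1 u v)%E.
  apply: integral_ge0 => s _; rewrite mule_ge0// lee_fin.
  by rewrite mulr_ge0 ?sqr_ge0// chi_div_ge0.
have I20 v : (0 <= I2 v)%E.
  by apply: integral_ge0 => s _; rewrite mule_ge0// lee_fin.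
have m2 v : measurable_fun setT
    (fun s : Rm => ((1 - chi s)%:E * (Normc.normc (F (v, s)) ^+ 2)%:E)%E).
  apply: emeasurable_funM => //; apply/measurable_EFinP.
  by apply: measurable_funB => //; exact: measurable_chi.
transitivity (\esum_(v in setT)
    ((if v \in nonroots T then I1 (parent T v) v else 0) + I2 v))%E.
  apply: eq_esum => v _; rewrite /csqnorm.
  under eq_integral do rewrite nsq_shift_phase EFinD EFinM [X in (_ + X)%E]EFinM.
  rewrite ge0_integralD//.
  - rewrite /cweight; case: ifPn => // _; congr (_ + _)%E.
    rewrite Normc.normc0 expr0n.
    by under eq_integral do rewrite !mul0r mul0e; rewrite integral0.
  - by move=> s _; rewrite mule_ge0// lee_fin mulr_ge0 ?sqr_ge0// chi_div_ge0.
  - apply: emeasurable_funM => //; apply/measurable_EFinP.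
    by apply: measurable_funM => //; exact: measurable_inv_pos.
  - by move=> s _; rewrite mule_ge0// lee_fin.
rewrite esumD//; last by move=> v _; case: ifP.
rewrite -esum_mkcond esum_children//.
rewrite -esumD//; last by move=> u _; exact: esum_ge0.
apply: eq_esum => u _; rewrite /csqnorm.
rewrite -(integral_consistent u (Fv0 u) (mFv u)) -ge0_integralD//.
- apply: eq_integral => s _; rewrite -!EFinM -EFinD -mulrDl addrC subrK mul1r//.
- by move=> s _; rewrite mule_ge0// lee_fin.
- apply: emeasurable_funM => //; apply/measurable_EFinP; exact: measurable_chi.
- by move=> s _; rewrite mule_ge0// lee_fin.
Qed.

Definition resolvent_weight (x : X) : R := (1 + Num.sqrt x.2)^-1.

Lemma resolvent_weight_gt0 x : 0 < resolvent_weight x.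
Proof. by rewrite invr_gt0 ltr_pwDl// sqrtr_ge0. Qed.

Lemma resolvent_weight_le1 x : resolvent_weight x <= 1.
Proof. by rewrite invf_le1 ?ltr_pwDl ?lerDl ?sqrtr_ge0. Qed.

Lemma measurable_resolvent_weight : measurable_fun setT resolvent_weight.
Proof.
apply: fibers_measurable_fun => v; apply: measurable_inv_ge0 => [s|].
  by rewrite addr_ge0// sqrtr_ge0.
by apply: measurable_funD => //; exact: measurable_sqrt.
Qed.

Definition embed (f : l2 R V) (x : X) : C := f x.1.

Lemma cmeasurable_fst (f : V -> C) : cmeasurable (fun x : X => f x.1).
Proof. by apply/cmeasurable_fiberP => v; split => /=; exact: measurable_cst. Qed.

(** Every fibre has total mass 1. *)
Lemma csqnorm_fst (f : V -> C) : csqnorm muX (fun x : X => f x.1) =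
  (\esum_(v in setT) (Normc.normc (f v) ^+ 2)%:E)%E.
Proof.
rewrite csqnorm_fibers; last exact: cmeasurable_fst.
apply: eq_esum => v _; rewrite /csqnorm /= integral_cst//.
by rewrite [X in (_ * X)%E](_ : _ = 1%E) ?mule1//; exact: probability_setT.
Qed.

Lemma sqint_embed (f : l2 R V) : sqint muX (embed f).
Proof.
split; first exact: cmeasurable_fst.
rewrite [X in (X < _)%E]csqnorm_fst.
exact: (l2_sqsummable f).
Qed.

Lemma hnsq_l2 (f : l2 R V) : hnsq f = l2_nsq f.
Proof. by rewrite /hnsq -[inner f f]/(l2_dot f f) l2_dotE. Qed.

Lemma hnsq_embed (f : l2 R V) : hnsq (L2_class muX (embed f)) = hnsq f.
Proof.
have := hnsq_L2_class (sqint_embed f).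
rewrite [csqnorm _ _]csqnorm_fst hnsq_l2 => e.
apply: EFin_inj; rewrite e /l2_nsq /psum fineK// ge0_fin_numE.
  exact: (l2_sqsummable f).
by apply: esum_ge0 => v _; rewrite lee_fin sqr_ge0.
Qed.

(** The intertwining relation. For s > 0 the two square roots cancel; for s <= 0 the left side is 0,
    since the real square root of such [s] is 0. *)
Lemma shift_phase_sqrt (f g : l2 R V) : graph (wshift T lambda) (f, g) ->
  {ae muX, forall x, shift_phase (fun x => (Num.sqrt x.2)%:C%C * f x.1) x = g x.1}.
Proof.
move=> fg; have gE v : g v = cweight v * f (parent T v).
  by rewrite (fg v) /Lambda /cweight /=; case: ifP; rewrite ?mul0r.
(* If [g v] is nonzero, then [v] has a parent and a nonzero weight, so [mu_off_pos] makes this slice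
   null. Null slices suffice even for uncountably many fibres, since the measure is an unordered sum
   over them. *)
pose E : set X := [set x | ~ P x.2 /\ g x.1 != 0].
have mP : measurable P by exact: measurable_itv.
exists E; split.
- move=> v; have [gv|gv] := eqVneq (g v) 0.
    by rewrite (_ : [set s | _] = set0)// -subset0 => s [] /=; rewrite gv eqxx.
  rewrite (_ : [set s | _] = ~` P); first exact: measurableC.
  by apply/seteqP; split=> s; [case|].
- rewrite -[LHS]/(\esum_(v in setT) mu v [set s | E (v, s)])%E esum1// => v _.
  have [gv|gv] := eqVneq (g v) 0.
    by rewrite (_ : [set s | _] = set0)// -subset0 => s [] /=; rewrite gv eqxx.
  rewrite (_ : [set s | _] = ~` P); last by apply/seteqP; split=> s; [case|].
  move: gv; rewrite gE mulf_eq0 negb_or /cweight => /andP[+ _].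
  case: ifPn => [/set_mem /existsNP[u /negP]|]; last by rewrite eqxx.
  by rewrite negbK => uv; exact: mu_off_pos uv.
move=> [v s] /=; apply: contra_notP => nE.
have [Ps|nPs] := pselect (P s).
  have s0 : Num.sqrt s != 0.
    by move: Ps; rewrite /= in_itv /= andbT -sqrtr_gt0 => /gt_eqF->.
  rewrite /shift_phase /= indicE mem_set//= subrr mul0r addr0 gE mul1r mulrA.
  by rewrite -[cweight v * _ * _]mulrA -rmorphM mulVf// mulr1.
have gv : g v = 0 by apply/eqP; apply: contrapT => /negP gv; apply: nE.
have s0 : Num.sqrt s = 0.
  by apply: ler0_sqrtr; move: nPs; rewrite /= in_itv /= andbT => /negP; rewrite -leNgt.
by rewrite /shift_phase /= indicE memNset//= mul0r mulr0 mul0r add0r s0 mul0r mulr0 gv.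
Qed.

Lemma wshift_normal_extension :
  exists (K : hilbertType R) (J : {linear l2 R V -> K}) (N : operator K),
    [/\ forall x, `|J x| = `|x|, normal_operator N &
        forall x y, graph (wshift T lambda) (x, y) -> graph N (J x, J y)].
Proof.
have shiftL (a : C) F G x :
    shift_phase (fun y => a * F y + G y) x = a * shift_phase F x + shift_phase G x.
  by rewrite /shift_phase; ring.
have [U Uiso UE] := L2_isometry cmeasurable_shift_phase shift_phase_isometric shiftL.
have [B [Bsym Binj BE]] := L2_multiplier muX
  measurable_resolvent_weight resolvent_weight_gt0 resolvent_weight_le1.
(* [resolvent_weight] depends on [s] alone, hence agrees at a point and at the point with the same
   [s] over the parent. *)
have UB p : U (B p) = B (U p).
  elim/L2_class_ind: p => F hF.
  have [sU UF] := UE F hF; have [sB BF] := BE F hF.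
  rewrite UF BF (UE _ sB).2 (BE _ sU).2; congr (L2_class _ _); apply/funext => x.
  by rewrite /shift_phase /resolvent_weight /=; ring.
have [N [Nnormal NE]] := quasinormal_normal_extension Bsym Binj Uiso UB.
pose j (f : l2 R V) : hsum (L2 muX) := (L2_class muX (embed f), 0).
have jL : linear j.
  move=> a f g; rewrite /j; congr pair; last by rewrite /= scaler0 addr0.
  by rewrite /= -L2_classP//; exact: sqint_embed.
pose J : {linear l2 R V -> hsum (L2 muX)} :=
  HB.pack j (GRing.isLinear.Build _ _ _ _ j jL).
exists (hsum (L2 muX)), J, N; split => // [f|f g fg].
  apply: hnsq_normr; rewrite hnsq_hsum /= hnsq_embed.
  by rewrite [hnsq 0]/hnsq inner0l addr0.
pose F (x : X) := (Num.sqrt x.2)%:C%C * f x.1.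
have mF : cmeasurable F.
  apply/cmeasurable_fiberP => v; apply: cmeasurableM.
    by apply: cmeasurable_real; exact: measurable_sqrt.
  by split => /=; exact: measurable_cst.
have aeF := shift_phase_sqrt fg.
(* The embedded [f] lies in the domain of [M] because [U] preserves norms: the norm of [F] equals
   that of its image, which is almost everywhere the embedded [g]. *)
have hF : sqint muX F.
  split=> //; rewrite -shift_phase_isometric//.
  rewrite (csqnorm_ae_eq (cmeasurable_shift_phase mF) (cmeasurable_fst g) aeF).
  exact: (sqint_embed g).2.
(* This is (1 + M) applied to the embedded [f], so [B z] is the embedded [f] and [z - B z] is the
   class of [F]. *)
pose z := L2_class muX F + L2_class muX (embed f).
have Bz : B z = L2_class muX (embed f).
  have -> : z = L2_class muX (fun x => 1 * F x + embed f x).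
    by rewrite L2_classP ?scale1r//; exact: sqint_embed.
  have hz := sqintP 1 hF (sqint_embed f).
  rewrite (BE _ hz).2; congr (L2_class _ _); apply/funext => x.
  rewrite /F /embed mul1r -[X in _ * (_ + X)]mul1r -mulrDl mulrA -rmorphD -rmorphM /=.
  by rewrite addrC mulVf ?mul1r// gt_eqF// ltr_pwDl// sqrtr_ge0.
have := NE z; rewrite Bz {1}/z addrK (UE _ hF).2.
rewrite (L2_class_eq (UE _ hF).1 (sqint_embed g) aeF).
exact.
Qed.

End consistent_system.

(** * Density of the span of the basis vectors *)

Section delta_span.
Context (R : realType) (V : choiceType).
Implicit Types f g : l2 R V.

Lemma l2_sumE (I : Type) (s : seq I) (F : I -> l2 R V) w :
  (\sum_(i <- s) F i) w = \sum_(i <- s) F i w.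
Proof. by apply: (big_morph (fun f : l2 R V => f w)). Qed.

Lemma l2_delta_sum f (s : seq V) w : uniq s ->
  (\sum_(v <- s) f v *: l2_delta R v) w = if w \in s then f w else 0.
Proof.
move=> us; rewrite l2_sumE.
transitivity (\sum_(v <- s) if v == w then f w else 0).
  apply: eq_bigr => v _; rewrite -[LHS]/(f v * (w == v)%:R) eq_sym.
  by case: eqP => [->|_]; rewrite ?mulr1 ?mulr0.
rewrite -big_mkcond /=; case: ifPn => ws; last first.
  by rewrite big_seq_cond big1// => v /andP[vs /eqP vw]; rewrite -vw vs in ws.
by rewrite -big_filter filter_pred1_uniq// big_seq1.
Qed.

Lemma lin_delta_sum f (s : seq V) :
  lin (range (@l2_delta R V)) (\sum_(v <- s) f v *: l2_delta R v).
Proof.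
case: s => [|v0 s].
  rewrite big_nil; exists 0%N, (fun=> 0), (fun=> 0); split=> [[]//|].
  by rewrite big_ord0.
exists (size (v0 :: s)), (fun i => f (nth v0 (v0 :: s) i)),
  (fun i => l2_delta R (nth v0 (v0 :: s) i)).
by split=> [i|]; [exists (nth v0 (v0 :: s) i)|rewrite (big_nth v0) big_mkord].
Qed.

(** The truncation of [f] to a finite set carrying all but [e] of its squared norm is a combination
    of basis vectors. *)
Lemma dense_lin_delta : dense (lin (range (@l2_delta R V))).
Proof.
apply: dense_hnsq => f e e0.
pose a v := (Normc.normc (f v) ^+ 2)%:E.
have a0 v : (0 <= a v)%E by rewrite lee_fin sqr_ge0.
have s0 S : (0 <= esum S a)%E by apply: esum_ge0 => v _; exact: a0.
have afin : (\esum_(v in setT) a v)%E \is a fin_num.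
  by rewrite ge0_fin_numE ?s0//; exact: (l2_sqsummable f).
have [_ [A [fA _] <-]] := ub_ereal_sup_adherent e0 afin.
rewrite -/(esum setT a) -(esum_fset fA); last by move=> v _; exact: a0.
have -> : esum setT a = (esum A a + esum (~` A) a)%E.
  by rewrite (esumID A) ?setTI// => v _; exact: a0.
move=> lt_e.
exists (\sum_(v <- finmap.enum_fset (fset_set A)) f v *: l2_delta R v).
  exact: lin_delta_sum.
set g := \sum_(_ <- _) _.
have gE w : (g - f) w = if w \in ~` A then - f w else 0.
  rewrite -[LHS]/(g w - f w) l2_delta_sum ?finmap.fset_uniq//.
  rewrite in_fset_set// in_setC; case: (w \in A) => /=; first by rewrite subrr.
  by rewrite sub0r.
rewrite /hnsq -[inner _ _]/(l2_dot _ _) l2_dotE /= -lte_fin.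
rewrite /l2_nsq /psum fineK; last first.
  apply: esum_ge0_fin => [v|]; first exact: sqr_ge0.
  exact: ((absum_nsq (g - f)).1 (l2_sqsummable (g - f))).
rewrite (_ : esum _ _ = esum (~` A) a); last first.
  rewrite [RHS]esum_mkcond; apply: eq_esum => v _; rewrite gE.
  case: ifP => _; first by rewrite /a !nsqE !raddfN /= !sqrrN.
  by rewrite Normc.normc0 expr0n.
have Afin : esum A a \is a fin_num.
  rewrite ge0_fin_numE ?s0//; apply: le_lt_trans (l2_sqsummable f : _ < +oo)%E.
  by rewrite esum_mkcond; apply: le_esum => v _; case: ifP => // _; exact: a0.
by move: lt_e; rewrite lteBlDr// lteD2lE.
Qed.

End delta_span.

Theorem theorem5p1p1 (R : realType) (V : choiceType) (T : directed_tree V)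
    (lambda : V -> R[i])
    (domE : lin (range (@l2_delta R V)) `<=` dom_infty (wshift T lambda))
    (mu : V -> probability (measurableTypeR R) R)
    (mu_Rplus : forall v : V, mu v `[0, +oo[%classic = 1%E)
    (eps : V -> R) (eps_ge0 : forall v : V, 0 <= eps v)
    (consistency : forall (u : V) (sigma : set (measurableTypeR R)),
      measurable sigma -> sigma `<=` `[0, +oo[%classic ->
      (mu u sigma =
         \esum_(v in children T u)
            ((Normc.normc (lambda v) ^+ 2)%:E *
             \int[mu v]_(s in sigma) (s%:E)^-1)
         + (eps u)%:E * \d_(0%R : measurableTypeR R) sigma)%E) :
  subnormal (wshift T lambda).
Proof.
split; last first.
  have [v0 _] := tree_nonempty T.
  exact: (wshift_normal_extension mu_Rplus consistency v0).
move=> O O0 oO; have [f [Of /domE fD]] := dense_lin_delta O0 oO.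
(* The first power is the shift composed with the diagonal, hence the extra vector [h] equal to
   [f]. *)
exists f; split=> //; have [g [h /= fh hg]] := fD 1%N I.
by exists g; rewrite [f]fh.
Qed.
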